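(* Work in CZF + wREA. Let $\Gamma:L\to L$ be a monotone operator on a set-presented $\bigvee$-semilattice $L$. If $\Gamma=\Gamma_\Phi$ for some bounded abstract inductive definition $\Phi$ on $L$, then $\Gamma$ has the least fixed point $p=\bigvee\mathcal I(\Phi)$.
   Context: CZF is the theory in first-order intuitionistic logic with equality, in the language of $\in$, with axioms and schemes: Extensionality; Pair; Union; Restricted Separation (only formulas all of whose quantifiers are of the form $\forall x\in b$, $\exists x\in c$); Infinity; Set Induction ($\forall a((\forall x\in a)\phi(x)\to\phi(a))\to\forall a\,\phi(a)$, for all $\phi$); Strong Collection ($\forall a((\forall x\in a)\exists y\,\phi(x,y)\to\exists b((\forall x\in a)(\exists y\in b)\phi(x,y)\wedge(\forall y\in b)(\exists x\in a)\phi(x,y)))$, for all $\phi$); Subset Collection ($\forall a\forall b\exists c\forall u((\forall x\in a)(\exists y\in b)\phi(x,y,u)\to(\exists d\in c)((\forall x\in a)(\exists y\in d)\phi(x,y,u)\wedge(\forall y\in d)(\exists x\in a)\phi(x,y,u)))$, for all $\phi$). A set $c$ is weakly regular if it is transitive, inhabited, and for any $u\in c$ and any set $R\subseteq u\times c$, if $(\forall x\in u)(\exists y)\,(x,y)\in R$ then there is $v\in c$ with $(\forall x\in u)(\exists y\in v)\,(x,y)\in R$. wREA is the axiom: every set is a subset of a weakly regular set. Classes are given by formulas as usual; $\mathrm{Pow}(X)$ is the class of all subsets of $X$ (subsets are sets). A partially ordered class $(L,\leq)$ is a class with a reflexive, transitive, antisymmetric class relation. It is a $\bigvee$-semilattice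 if every subset of $L$ has a supremum. A $\bigvee$-semilattice $L$ is set-generated by $B$ if $B$ is a subset of $L$ such that for all $x\in L$: (i) $\downarrow^B x=\{b\in B\mid b\leq x\}$ is a set; (ii) $x=\bigvee\downarrow^B x$. A $\bigvee$-semilattice $L$ set-generated by $B$ is set-presented if a mapping $D:B\to\mathrm{Pow}(\mathrm{Pow}(B))$ is given such that $b\leq\bigvee U\iff(\exists W\in D(b))\,W\subseteq U$ for every $b\in B$ and $U\in\mathrm{Pow}(B)$. A monotone operator on $L$ is a (class) function $\Gamma:L\to L$ such that $a_1\leq a_2$ implies $\Gamma(a_1)\leq\Gamma(a_2)$. An abstract inductive definition on $L$ is any class of ordered pairs $\Phi\subseteq B\times L$. A bound for $\Phi$ is a set $\alpha$ such that whenever $(b,a)\in\Phi$ there is $x\in\alpha$ such that the set $\downarrow^B a$ is an image of $x$ (i.e. there is a surjection $x\twoheadrightarrow\,\downarrow^B a$). $\Phi$ is bounded if $\{b\in B\mid(b,a)\in\Phi\}$ is a set for every $a\in L$, and $\Phi$ has a bound. $\Phi$ is local if for every $a\in L$ the class $\{b\in B\mid(\exists a')\ (b,a')\in\Phi\ \&\ a'\leq a\}$ is a set; for local $\Phi$ one defines $\Gamma_\Phi:L\to L$ by $\Gamma_\Phi(a)=\bigvee\{b\in B\mid(\exists a')\ (b,a')\in\Phi\ \&\ a'\leq a\}$. In CZF every bounded $\Phi$ is local, so $\Gamma_\Phi$ is defined for bounded $\Phi$. A subclass $Y\subseteq B$ is $c_L$-closed if for every subset $U$ of $Y$ one has $\downarrow^B\bigvee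 U\subseteq Y$. A class $Y\subseteq B$ is $\Phi$-closed if it is $c_L$-closed and, whenever $(b,a)\in\Phi$ and $\downarrow^B a\subseteq Y$, also $b\in Y$. $\mathcal I(\Phi)$ denotes the least (with respect to inclusion) $\Phi$-closed class; under the hypotheses of the claim it exists and is a set, so that its join in $L$ is meaningful. *)

(* Defs.v *)
From Stdlib Require Import List.
Import ListNotations.

(** * Intuitionistic first-order logic with equality, signature {∈} *)

(** De Bruijn formulas.  There are no function symbols, so every term is a
    variable and substitution is renaming. *)
Inductive form : Type :=
| Bot : form
| Eq  : nat -> nat -> form
| Mem : nat -> nat -> form
| And : form -> form -> form
| Or  : form -> form -> form
| Imp : form -> form -> form
| All : form -> form
| Ex  : form -> form.

Definition up (r : nat -> nat) (i : nat) : nat :=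
  match i with 0 => 0 | S j => S (r j) end.

Fixpoint ren (r : nat -> nat) (A : form) : form :=
  match A with
  | Bot => Bot
  | Eq i j => Eq (r i) (r j)
  | Mem i j => Mem (r i) (r j)
  | And A B => And (ren r A) (ren r B)
  | Or A B => Or (ren r A) (ren r B)
  | Imp A B => Imp (ren r A) (ren r B)
  | All A => All (ren (up r) A)
  | Ex A => Ex (ren (up r) A)
  end.

(** [inst t A] replaces variable 0 of [A] by [t] and lowers the others. *)
Definition inst (t : nat) (A : form) : form :=
  ren (fun i => match i with 0 => t | S j => j end) A.

(** Natural deduction from a set [T] of axioms.  Axioms may have free variables
    (parameters), which are read as universally quantified: [d_ax] is available
    in every context, in particular below [d_allI]. *)
Inductive deriv (T : form -> Prop) : list form -> form -> Prop :=
| d_ax   G A : T A -> deriv T G A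
| d_hyp  G A : In A G -> deriv T G A
| d_botE G A : deriv T G Bot -> deriv T G A
| d_andI G A B : deriv T G A -> deriv T G B -> deriv T G (And A B)
| d_andEl G A B : deriv T G (And A B) -> deriv T G A
| d_andEr G A B : deriv T G (And A B) -> deriv T G B
| d_orIl G A B : deriv T G A -> deriv T G (Or A B)
| d_orIr G A B : deriv T G B -> deriv T G (Or A B)
| d_orE  G A B C : deriv T G (Or A B) ->
    deriv T (A :: G) C -> deriv T (B :: G) C -> deriv T G C
| d_impI G A B : deriv T (A :: G) B -> deriv T G (Imp A B)
| d_impE G A B : deriv T G (Imp A B) -> deriv T G A -> deriv T G B
| d_allI G A : deriv T (map (ren S) G) A -> deriv T G (All A)
| d_allE G A t : deriv T G (All A) -> deriv T G (inst t A)
| d_exI  G A t : deriv T G (inst t A) -> deriv T G (Ex A)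
| d_exE  G A C : deriv T G (Ex A) ->
    deriv T (A :: map (ren S) G) (ren S C) -> deriv T G C
| d_eqI  G t : deriv T G (Eq t t)
| d_eqE  G A s t : deriv T G (Eq s t) ->
    deriv T G (inst s A) -> deriv T G (inst t A).

(** * Writing formulas with named bound variables *)

(** A [fm] yields a formula once it is told how many of its own binders it lies
    under, and a [tm] yields the de Bruijn index of a variable at that depth.
    A binder placed at depth [d] is [e - S d] at depth [e]; the free variable
    [k] is [e + k]. *)
Definition tm := nat -> nat.
Definition fm := nat -> form.

Definition fv (k : nat) : tm := fun e => e + k.

Definition fBot : fm := fun _ => Bot.
Definition fEq  (s t : tm) : fm := fun d => Eq (s d) (t d).
Definition fMem (s t : tm) : fm := fun d => Mem (s d) (t d).
Definition fAnd (P Q : fm) : fm := fun d => And (P d) (Q d).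
Definition fOr  (P Q : fm) : fm := fun d => Or (P d) (Q d).
Definition fImp (P Q : fm) : fm := fun d => Imp (P d) (Q d).
Definition fAll (P : tm -> fm) : fm := fun d => All (P (fun e => e - S d) (S d)).
Definition fEx  (P : tm -> fm) : fm := fun d => Ex (P (fun e => e - S d) (S d)).

Definition close (P : fm) : form := P 0.

Declare Scope fm_scope.
Delimit Scope fm_scope with fm.
Bind Scope fm_scope with fm.

Notation "s ≐ t" := (fEq s t) (at level 70, no associativity) : fm_scope.
Notation "s ∈ t" := (fMem s t) (at level 70, no associativity) : fm_scope.
Notation "P ∧ Q" := (fAnd P Q) (at level 80, right associativity) : fm_scope.
Notation "P ∨ Q" := (fOr P Q) (at level 85, right associativity) : fm_scope.
Notation "P ⟶ Q" := (fImp P Q) (at level 90, right associativity) : fm_scope.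
Notation "P ⟷ Q" := (fAnd (fImp P Q) (fImp Q P))
  (at level 95, no associativity) : fm_scope.
Notation "∀ x , P" := (fAll (fun x => P%fm))
  (at level 10, x name, P at level 200) : fm_scope.
Notation "∃ x , P" := (fEx (fun x => P%fm))
  (at level 10, x name, P at level 200) : fm_scope.
Notation "∀ x ∈ a , P" := (fAll (fun x => fImp (fMem x a) P%fm))
  (at level 10, x name, a at level 69, P at level 200) : fm_scope.
Notation "∃ x ∈ a , P" := (fEx (fun x => fAnd (fMem x a) P%fm))
  (at level 10, x name, a at level 69, P at level 200) : fm_scope.

Local Open Scope fm_scope.

(** [fapp A [t0; ...; tn]]: variables [0..n] of [A] become [t0..tn], and variable
    [n + 1 + k] of [A], a parameter, becomes the free variable [k]. *)
Definition fapp (A : form) (ts : list tm) : fm := fun d =>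
  ren (fun i => match nth_error ts i with
                | Some t => t d
                | None => fv (i - length ts) d
                end) A.

(** Classes.  The class given by [A] is {x | A(x)}, with variable 0 of [A] as
    [x] and the remaining variables of [A] as parameters. *)
Definition class := tm -> fm.

Definition cls (A : form) : class := fun x => fapp A [x].
Definition elts (a : tm) : class := fun x => x ∈ a.

Definition sub_class (X Y : class) : fm := ∀ x, X x ⟶ Y x.
Definition is_set_of (s : tm) (X : class) : fm := ∀ x, x ∈ s ⟷ X x.
Definition is_set (X : class) : fm := ∃ s, is_set_of s X.
Definition subset (a b : tm) : fm := ∀ x ∈ a, x ∈ b.

Definition Pow (X : class) : class := fun u => ∀ x ∈ u, X x.

(** Kuratowski pairs: [w = {x, y}] and [z = (x, y)]. *)
Definition is_upair (w x y : tm) : fm :=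
  x ∈ w ∧ y ∈ w ∧ (∀ v ∈ w, v ≐ x ∨ v ≐ y).
Definition is_pair (z x y : tm) : fm :=
  (∃ w ∈ z, is_upair w x x) ∧ (∃ w ∈ z, is_upair w x y) ∧
  (∀ w ∈ z, is_upair w x x ∨ is_upair w x y).

(** [holds R x y] is (x, y) ∈ R. *)
Definition holds (R : class) (x y : tm) : fm := ∃ z, is_pair z x y ∧ R z.

Definition sub_prod (R X Y : class) : fm :=
  ∀ z, R z ⟶ ∃ x, ∃ y, X x ∧ Y y ∧ is_pair z x y.

Definition is_function (F X Y : class) : fm :=
  sub_prod F X Y ∧
  (∀ x, X x ⟶ ∃ y, holds F x y) ∧
  (∀ x, ∀ y, ∀ y', holds F x y ⟶ holds F x y' ⟶ y ≐ y').

(** * The theory CZF + wREA *)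

(** Restricted formulas: the bound of a bounded quantifier is a variable other
    than the one it binds, hence the index [S t]. *)
Inductive restricted : form -> Prop :=
| r_bot : restricted Bot
| r_eq i j : restricted (Eq i j)
| r_mem i j : restricted (Mem i j)
| r_and A B : restricted A -> restricted B -> restricted (And A B)
| r_or A B : restricted A -> restricted B -> restricted (Or A B)
| r_imp A B : restricted A -> restricted B -> restricted (Imp A B)
| r_ball t A : restricted A -> restricted (All (Imp (Mem 0 (S t)) A))
| r_bex t A : restricted A -> restricted (Ex (And (Mem 0 (S t)) A)).

Definition weakly_regular (c : tm) : fm :=
  (∀ x ∈ c, subset x c) ∧
  (∃ x, x ∈ c) ∧
  (∀ u ∈ c, ∀ R, sub_prod (elts R) (elts u) (elts c) ⟶
     (∀ x ∈ u, ∃ y, holds (elts R) x y) ⟶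
     ∃ v ∈ c, ∀ x ∈ u, ∃ y ∈ v, holds (elts R) x y).

Inductive CZF_wREA : form -> Prop :=
| extensionality : CZF_wREA (close (
    ∀ a, ∀ b, (∀ x, x ∈ a ⟷ x ∈ b) ⟶ a ≐ b))
| pairing : CZF_wREA (close (
    ∀ a, ∀ b, ∃ c, ∀ x, x ∈ c ⟷ x ≐ a ∨ x ≐ b))
| union : CZF_wREA (close (
    ∀ a, ∃ c, ∀ x, x ∈ c ⟷ (∃ y ∈ a, x ∈ y)))
| restricted_separation A : restricted A -> CZF_wREA (close (
    ∀ a, ∃ b, ∀ x, x ∈ b ⟷ x ∈ a ∧ fapp A [x]))
| infinity : CZF_wREA (close (
    ∃ a, (∃ x ∈ a, ∀ y, y ∈ x ⟶ fBot) ∧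
         (∀ x ∈ a, ∃ y ∈ a, ∀ z, z ∈ y ⟷ z ∈ x ∨ z ≐ x)))
| set_induction A : CZF_wREA (close (
    (∀ a, (∀ x ∈ a, fapp A [x]) ⟶ fapp A [a]) ⟶ ∀ a, fapp A [a]))
| strong_collection A : CZF_wREA (close (
    ∀ a, (∀ x ∈ a, ∃ y, fapp A [x; y]) ⟶
      ∃ b, (∀ x ∈ a, ∃ y ∈ b, fapp A [x; y]) ∧
           (∀ y ∈ b, ∃ x ∈ a, fapp A [x; y])))
| subset_collection A : CZF_wREA (close (
    ∀ a, ∀ b, ∃ c, ∀ u, (∀ x ∈ a, ∃ y ∈ b, fapp A [x; y; u]) ⟶
      ∃ d ∈ c, (∀ x ∈ a, ∃ y ∈ d, fapp A [x; y; u]) ∧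
               (∀ y ∈ d, ∃ x ∈ a, fapp A [x; y; u])))
| wREA : CZF_wREA (close (
    ∀ a, ∃ c, subset a c ∧ weakly_regular c)).

(** [P] may have free variables; deriving it amounts to deriving its universal
    closure. *)
Definition provable (P : fm) : Prop := deriv CZF_wREA [] (close P).

(** * Set-presented ⋁-semilattices *)

Definition partial_order (L le : class) : fm :=
  sub_prod le L L ∧
  (∀ x, L x ⟶ holds le x x) ∧
  (∀ x, ∀ y, ∀ z, holds le x y ⟶ holds le y z ⟶ holds le x z) ∧
  (∀ x, ∀ y, holds le x y ⟶ holds le y x ⟶ x ≐ y).

(** [x = ⋁ U] for a set [U] of elements of [L]. *)
Definition is_sup (L le : class) (U x : tm) : fm :=
  L x ∧ (∀ u ∈ U, holds le u x) ∧
  (∀ y, L y ⟶ (∀ u ∈ U, holds le u y) ⟶ holds le x y).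

Definition sup_semilattice (L le : class) : fm :=
  partial_order L le ∧ (∀ U, Pow L U ⟶ ∃ x, is_sup L le U x).

(** The class ↓^B x. *)
Definition down (le : class) (B x : tm) : class := fun b => b ∈ B ∧ holds le b x.

Definition set_generated (L le : class) (B : tm) : fm :=
  sup_semilattice L le ∧ Pow L B ∧
  (∀ x, L x ⟶ ∃ s, is_set_of s (down le B x) ∧ is_sup L le s x).

Definition set_presented (L le : class) (B : tm) (D : class) : fm :=
  set_generated L le B ∧
  is_function D (elts B) (Pow (Pow (elts B))) ∧
  (∀ b ∈ B, ∀ U, Pow (elts B) U ⟶
     ((∃ j, is_sup L le U j ∧ holds le b j) ⟷
      (∃ V, holds D b V ∧ ∃ W ∈ V, subset W U))).

Definition monotone_operator (L le Gam : class) : fm :=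
  is_function Gam L L ∧
  (∀ a1, ∀ a2, ∀ c1, ∀ c2, holds le a1 a2 ⟶
     holds Gam a1 c1 ⟶ holds Gam a2 c2 ⟶ holds le c1 c2).

(** * Abstract inductive definitions *)

Definition abstract_ind_def (L : class) (B : tm) (Phi : class) : fm :=
  sub_prod Phi (elts B) L.

(** [f] is a surjection from the set [x] onto the set [s]. *)
Definition surjection (f x s : tm) : fm :=
  is_function (elts f) (elts x) (elts s) ∧
  (∀ v ∈ s, ∃ u ∈ x, holds (elts f) u v).

Definition is_bound (le : class) (B : tm) (Phi : class) (alpha : tm) : fm :=
  ∀ b, ∀ a, holds Phi b a ⟶
    ∃ x ∈ alpha, ∃ s, is_set_of s (down le B a) ∧ ∃ f, surjection f x s.

Definition bounded (L le : class) (B : tm) (Phi : class) : fm :=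
  (∀ a, L a ⟶ is_set (fun b => b ∈ B ∧ holds Phi b a)) ∧
  (∃ alpha, is_bound le B Phi alpha).

(** [y = Γ_Φ(a)].  Stated as a relation because joins are only available for
    sets; for bounded [Phi] the class below is a set. *)
Definition is_Gamma_of (L le : class) (B : tm) (Phi : class) (a y : tm) : fm :=
  ∃ s, is_set_of s (fun b => b ∈ B ∧ ∃ a', holds Phi b a' ∧ holds le a' a) ∧
       is_sup L le s y.

Definition eq_Gamma_of (L le : class) (B : tm) (Phi Gam : class) : fm :=
  ∀ a, L a ⟶ ∀ y, holds Gam a y ⟷ is_Gamma_of L le B Phi a y.

Definition c_closed (L le : class) (B : tm) (Y : class) : fm :=
  ∀ U, Pow Y U ⟶ ∀ j, is_sup L le U j ⟶ sub_class (down le B j) Y.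

Definition Phi_closed (L le : class) (B : tm) (Phi Y : class) : fm :=
  sub_class Y (elts B) ∧
  c_closed L le B Y ∧
  (∀ b, ∀ a, holds Phi b a ⟶ sub_class (down le B a) Y ⟶ Y b).

Definition least_fixed_point (L le Gam : class) (p : tm) : fm :=
  L p ∧ holds Gam p p ∧ (∀ x, L x ⟶ holds Gam x x ⟶ holds le p x).

(* Main.v *)
(** A class [Y ⊆ B] is Φ-closed iff it is closed under the rules [b ≤ ⋁U, U ⊆ Y] and
    [(b, a) ∈ Φ, ↓a ⊆ Y].  For a set [a] let [J_a] be the class of all [b] with
    [b ≤ q] or [(b, a') ∈ Φ] for some [a' ≤ q], where [q] is the join of a set of
    elements of the earlier stages.  Then [I = ⋃_a J_a] is contained in every
    Φ-closed class, and each [J_a] is a set, namely [↓q] together with the set of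
    generators of [Γ q], for [q] the join of all earlier stages.
    Let [A] be weakly regular, containing a bound for Φ and all elements of the sets
    [D(b)].  If the premise of a rule lies in [⋃_{a ∈ A} J_a], then it is covered by
    [⋃_{a ∈ v} J_a] for some [v ∈ A]: for the first kind of rule the premise may be
    taken in [D(b)], for the second it is an image of an element of the bound.  So the
    conclusion lies in [J_v], and [I = ⋃_{a ∈ A} J_a] is a Φ-closed set.
    If [Γ x ≤ x] then [↓x] is Φ-closed, whence [⋁I ≤ x]; and [Γ(⋁I) ≤ ⋁I] because
    [↓⋁I ⊆ I].  So [⋁I] is the least fixed point.

    Derivability is handled semantically: [G ⊢ ∀x, P x] holds iff [G ⊢ P x] for all
    variables [x], and an implication may be proved in all contexts extending [G],
    so that Rocq variables and hypotheses play the role of eigenvariables and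
    assumptions. *)
From Stdlib Require Import List Lia PeanoNat.
Import ListNotations.
Require Import Defs.

Local Open Scope fm_scope.

(** * Renaming and free variables *)

Lemma up_ext r s : (forall i, r i = s i) -> forall i, up r i = up s i.
Proof. intros H [|i]; simpl; auto. Qed.

Lemma ren_ext A : forall r s, (forall i, r i = s i) -> ren r A = ren s A.
Proof. induction A; simpl; intros r s H; f_equal; auto using up_ext. Qed.

Lemma ren_ren A : forall r s, ren r (ren s A) = ren (fun i => r (s i)) A.
Proof.
  induction A; simpl; intros r s; f_equal; auto;
    (rewrite IHA; apply ren_ext; intros [|i]; reflexivity).
Qed.

Lemma ren_id A : forall r, (forall i, r i = i) -> ren r A = A.
Proof.
  induction A; simpl; intros r H; f_equal; auto;
    (apply IHA; intros [|i]; simpl; auto).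
Qed.

Fixpoint fv_bound (A : form) : nat :=
  match A with
  | Bot => 0
  | Eq i j | Mem i j => S (max i j)
  | And A B | Or A B | Imp A B => max (fv_bound A) (fv_bound B)
  | All A | Ex A => pred (fv_bound A)
  end.

Lemma ren_agree A : forall r s,
  (forall i, i < fv_bound A -> r i = s i) -> ren r A = ren s A.
Proof.
  induction A; cbn [ren fv_bound]; intros r s H; f_equal; try reflexivity;
    try (apply H; lia);
    try (apply IHA1; intros; apply H; lia);
    try (apply IHA2; intros; apply H; lia);
    (apply IHA; intros [|i] Hi; simpl; [reflexivity | f_equal; apply H; lia]).
Qed.

Lemma ren_ids A r : (forall i, i < fv_bound A -> r i = i) -> ren r A = A.
Proof.
  intros H. rewrite (ren_agree A r (fun i => i)) by exact H.
  apply ren_id; reflexivity.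
Qed.

Lemma fapp1E A t d :
  fapp A [t] d = ren (fun i => match i with 0 => t d | S j => d + j end) A.
Proof.
  apply ren_ext. intros [|[|i]]; simpl; unfold fv; f_equal; lia.
Qed.

Lemma fapp2E A t u d :
  fapp A [t; u] d =
  ren (fun i => match i with 0 => t d | 1 => u d | S (S j) => d + j end) A.
Proof.
  apply ren_ext. intros [|[|[|i]]]; simpl; unfold fv; f_equal; lia.
Qed.

Lemma fapp3E A t u v d :
  fapp A [t; u; v] d =
  ren (fun i => match i with 0 => t d | 1 => u d | 2 => v d
                | S (S (S j)) => d + j end) A.
Proof.
  apply ren_ext. intros [|[|[|[|i]]]]; simpl; unfold fv; f_equal; lia.
Qed.

Lemma restricted_ren A : restricted A -> forall r, restricted (ren r A).
Proof. induction 1; intros r; simpl; constructor; auto. Qed.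

Ltac ren_axiom :=
  unfold close, fAll, fEx, fImp, fAnd, fOr, fMem, fEq;
  rewrite ?fapp1E, ?fapp2E, ?fapp3E; simpl;
  rewrite ?ren_ren;
  repeat lazymatch goal with
  | |- ren _ _ = ren _ _ => apply ren_ext; intros [|[|[|i]]]; reflexivity
  | |- _ = _ => f_equal
  end.

(** Axioms may carry parameters and are usable under [d_allI], so stability of derivations under
    renaming needs every renamed instance of a scheme to be an instance again. The parameters of the
    scheme's formula are renamed and its argument places are kept. *)
Lemma CZF_wREA_ren A r : CZF_wREA A -> CZF_wREA (ren r A).
Proof.
  intros H. destruct H as [| | |A HA| |A|A|A|].
  - apply extensionality.
  - apply pairing.
  - apply union.
  - enough (E : forall P, P = close (
      ∀ a, ∃ b, ∀ x, x ∈ b ⟷ x ∈ a ∧ fapp (ren (up r) A) [x]) -> CZF_wREA P).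
    { apply E. ren_axiom. }
    intros P ->. apply restricted_separation. apply restricted_ren, HA.
  - apply infinity.
  - enough (E : forall P, P = close (
      (∀ a, (∀ x ∈ a, fapp (ren (up r) A) [x]) ⟶ fapp (ren (up r) A) [a])
        ⟶ ∀ a, fapp (ren (up r) A) [a]) -> CZF_wREA P).
    { apply E. ren_axiom. }
    intros P ->. apply set_induction.
  (* One [up] for each variable that [fapp] fills, so that only the parameters are moved. *)
  - enough (E : forall P, P = close (let A := ren (up (up r)) A in
      ∀ a, (∀ x ∈ a, ∃ y, fapp A [x; y]) ⟶
      ∃ b, (∀ x ∈ a, ∃ y ∈ b, fapp A [x; y]) ∧
           (∀ y ∈ b, ∃ x ∈ a, fapp A [x; y])) -> CZF_wREA P).
    { apply E. ren_axiom. }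
    intros P ->. apply strong_collection.
  - enough (E : forall P, P = close (let A := ren (up (up (up r))) A in
      ∀ a, ∀ b, ∃ c, ∀ u, (∀ x ∈ a, ∃ y ∈ b, fapp A [x; y; u]) ⟶
      ∃ d ∈ c, (∀ x ∈ a, ∃ y ∈ d, fapp A [x; y; u]) ∧
               (∀ y ∈ d, ∃ x ∈ a, fapp A [x; y; u])) -> CZF_wREA P).
    { apply E. ren_axiom. }
    intros P ->. apply subset_collection.
  - apply wREA.
Qed.

Lemma inst_ren r t A : ren r (inst t A) = inst (r t) (ren (up r) A).
Proof.
  unfold inst. rewrite !ren_ren. apply ren_ext. intros [|i]; reflexivity.
Qed.

Lemma map_ren_ren r s G :
  map (ren r) (map (ren s) G) = map (ren (fun i => r (s i))) G.
Proof. rewrite map_map. apply map_ext. intros A. apply ren_ren. Qed.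

Lemma map_ren_up r G :
  map (ren S) (map (ren r) G) = map (ren (up r)) (map (ren S) G).
Proof. rewrite !map_ren_ren. reflexivity. Qed.

Lemma deriv_ren G A : deriv CZF_wREA G A ->
  forall r, deriv CZF_wREA (map (ren r) G) (ren r A).
Proof.
  induction 1; intros r; simpl in *.
  - apply d_ax, CZF_wREA_ren; assumption.
  - apply d_hyp, in_map; assumption.
  - apply d_botE; auto.
  - apply d_andI; auto.
  - eapply d_andEl; auto.
  - eapply d_andEr; auto.
  - apply d_orIl; auto.
  - apply d_orIr; auto.
  - eapply d_orE; auto.
  - apply d_impI; auto.
  - eapply d_impE; auto.
  - apply d_allI. rewrite map_ren_up. auto.
  - rewrite inst_ren. apply d_allE; auto.
  - apply d_exI with (r t). rewrite <- inst_ren. auto.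
  - eapply d_exE; [apply IHderiv1|]. rewrite map_ren_up.
    specialize (IHderiv2 (up r)).
    replace (ren S (ren r C)) with (ren (up r) (ren S C))
      by (rewrite !ren_ren; reflexivity).
    exact IHderiv2.
  - apply d_eqI.
  - rewrite inst_ren. eapply d_eqE; [apply IHderiv1|].
    rewrite <- inst_ren. auto.
Qed.

Lemma deriv_weak G A : deriv CZF_wREA G A ->
  forall G', incl G G' -> deriv CZF_wREA G' A.
Proof.
  induction 1; intros G' HG;
    [ apply d_ax | apply d_hyp | apply d_botE | apply d_andI | eapply d_andEl
    | eapply d_andEr | apply d_orIl | apply d_orIr | eapply d_orE | apply d_impI
    | eapply d_impE | apply d_allI | apply d_allE | eapply d_exI | eapply d_exE
    | apply d_eqI | eapply d_eqE ]; eauto using incl_map, incl_cons, in_eq, incl_tl.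
Qed.

(* Any name above all free variables serves as the fresh one; the renaming
   [rotate n] brings it to index 0 and shifts the others out of the way. *)
Definition rotate (n i : nat) : nat := if i =? n then 0 else S i.

Lemma rotate_S n A : fv_bound A <= n -> ren (rotate n) A = ren S A.
Proof.
  intros H. apply ren_agree. intros i Hi. unfold rotate.
  destruct (Nat.eqb_spec i n); [lia | reflexivity].
Qed.

Lemma rotate_inst n A : fv_bound A <= n -> ren (rotate n) (inst n A) = A.
Proof.
  intros H. unfold inst. rewrite ren_ren. apply ren_ids. intros [|i] Hi;
    unfold rotate; [now rewrite Nat.eqb_refl|].
  destruct (Nat.eqb_spec i n); [lia | reflexivity].
Qed.

Definition ctx_bound (G : list form) : nat := list_max (map fv_bound G).

Lemma rotate_ctx n G : ctx_bound G <= n -> map (ren (rotate n)) G = map (ren S) G.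
Proof.
  intros H. apply map_ext_in. intros A HA. apply rotate_S.
  apply list_max_le in H. rewrite Forall_forall in H.
  apply H, in_map, HA.
Qed.

(** Only finitely many variables occur in [G] and [A], so among all the instances in the premise
    there is one at a fresh variable; [rotate n] turns it into the premise of [d_allI]. *)
Lemma deriv_all G A :
  (forall x, deriv CZF_wREA G (inst x A)) -> deriv CZF_wREA G (All A).
Proof.
  intros H. set (n := max (ctx_bound G) (fv_bound A)).
  apply d_allI. pose proof (deriv_ren _ _ (H n) (rotate n)) as D.
  rewrite rotate_inst, rotate_ctx in D by lia. exact D.
Qed.

Lemma deriv_ex G A C : deriv CZF_wREA G (Ex A) ->
  (forall x, deriv CZF_wREA (inst x A :: G) C) -> deriv CZF_wREA G C.
Proof.
  intros E H. set (n := max (ctx_bound G) (max (fv_bound A) (fv_bound C))).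
  apply d_exE with A; [exact E|].
  pose proof (deriv_ren _ _ (H n) (rotate n)) as D. simpl in D.
  rewrite rotate_inst, rotate_ctx, rotate_S in D by lia. exact D.
Qed.

(** * Parametricity of formulas with named binders *)

(* A level is a renaming from depth [ldom] to depth [lcod] that
   fixes the free variables, i.e. sends [fv j] to [fv j]. *)
Record level := Level {
  lren : nat -> nat;
  ldom : nat;
  lcod : nat;
  lfix : forall j, lren (ldom + j) = lcod + j }.

Definition lup (l : level) : level :=
  Level (up (lren l)) (S (ldom l)) (S (lcod l))
    (fun j => f_equal S (lfix l j)).

Fixpoint lupn (k : nat) (l : level) : level :=
  match k with 0 => l | S k => lupn k (lup l) end.

(** The first two clauses say that the indices shift by one with each further binder, as those of a
    genuine variable do; the third that the two indices at the level itself correspond under the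
    renaming. *)
Definition trel (l : level) (t t' : tm) : Prop :=
  (forall k, t (k + ldom l) = k + t (ldom l)) /\
  (forall k, t' (k + lcod l) = k + t' (lcod l)) /\
  t' (lcod l) = lren l (t (ldom l)).

Definition frel (l : level) (P P' : fm) : Prop :=
  P' (lcod l) = ren (lren l) (P (ldom l)).

(** Quantifying over [k] is a Kripke-style closure: a class may be used under further binders than
    those at which it was given. *)
Definition crel (l : level) (X X' : class) : Prop :=
  forall k t t', trel (lupn k l) t t' -> frel (lupn k l) (X t) (X' t').

(** Excludes functions that inspect the depth and so do not come from a formula with a hole. For
    parametric classes, substitution into the body agrees with application. *)
Definition par (X : class) : Prop :=
  forall l t t', trel l t t' -> frel l (X t) (X t').

Definition par2 (X : tm -> class) : Prop :=
  forall l t t' u u', trel l t t' -> trel l u u' -> frel l (X t u) (X t' u').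

Lemma trel_fv l k : trel l (fv k) (fv k).
Proof.
  unfold trel, fv. repeat split; intros; try lia. symmetry; apply lfix.
Qed.

Lemma trel_up l t t' : trel l t t' -> trel (lup l) t t'.
Proof.
  intros (H1 & H2 & H3).
  pose proof (H1 1) as E1. pose proof (H2 1) as E2. simpl in E1, E2.
  unfold trel; simpl. rewrite E1, E2. repeat split; [| |simpl; congruence];
    intros k; rewrite <- Nat.add_succ_comm; [rewrite H1 | rewrite H2]; simpl; lia.
Qed.

Lemma trel_upn k : forall l t t', trel l t t' -> trel (lupn k l) t t'.
Proof. induction k; simpl; auto using trel_up. Qed.

Lemma crel_up l X X' : crel l X X' -> crel (lup l) X X'.
Proof. intros H k. apply (H (S k)). Qed.

Lemma crel_upn k : forall l X X', crel l X X' -> crel (lupn k l) X X'.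
Proof. induction k; simpl; auto using crel_up. Qed.

Lemma crel_app l X X' t t' : crel l X X' -> trel l t t' -> frel l (X t) (X' t').
Proof. intros H. apply (H 0). Qed.

Lemma par_crel X l : par X -> crel l X X.
Proof. intros H k t t'. apply H. Qed.

Lemma frel_eq l s s' t t' :
  trel l s s' -> trel l t t' -> frel l (s ≐ t) (s' ≐ t').
Proof. intros (_ & _ & H) (_ & _ & H'). red. unfold fEq. simpl. congruence. Qed.

Lemma frel_mem l s s' t t' :
  trel l s s' -> trel l t t' -> frel l (s ∈ t) (s' ∈ t').
Proof. intros (_ & _ & H) (_ & _ & H'). red. unfold fMem. simpl. congruence. Qed.

Lemma frel_and l P P' Q Q' :
  frel l P P' -> frel l Q Q' -> frel l (P ∧ Q) (P' ∧ Q').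
Proof. unfold frel, fAnd. simpl. congruence. Qed.

Lemma frel_or l P P' Q Q' :
  frel l P P' -> frel l Q Q' -> frel l (P ∨ Q) (P' ∨ Q').
Proof. unfold frel, fOr. simpl. congruence. Qed.

Lemma frel_imp l P P' Q Q' :
  frel l P P' -> frel l Q Q' -> frel l (P ⟶ Q) (P' ⟶ Q').
Proof. unfold frel, fImp. simpl. congruence. Qed.

Lemma trel_binder l : trel (lup l) (fun e => e - S (ldom l)) (fun e => e - S (lcod l)).
Proof.
  unfold trel; simpl. rewrite !Nat.sub_diag. repeat split; intros; lia.
Qed.

Lemma frel_all l Q Q' :
  (forall t t', trel (lup l) t t' -> frel (lup l) (Q t) (Q' t')) ->
  frel l (fAll Q) (fAll Q').
Proof.
  intros H. red. unfold fAll. simpl. f_equal. apply (H _ _ (trel_binder l)).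
Qed.

Lemma frel_ex l Q Q' :
  (forall t t', trel (lup l) t t' -> frel (lup l) (Q t) (Q' t')) ->
  frel l (fEx Q) (fEx Q').
Proof.
  intros H. red. unfold fEx. simpl. f_equal. apply (H _ _ (trel_binder l)).
Qed.

Create HintDb par.
#[local] Hint Resolve trel_fv trel_up trel_upn crel_up crel_upn crel_app
  frel_eq frel_mem frel_and frel_or frel_imp frel_all frel_ex : par.
#[local] Hint Extern 1 (crel _ (fun _ => _) _) =>
  let k := fresh "k" in intros k ? ? ?; cbv beta : par.
#[local] Hint Extern 1 (par _) => intros ? ? ? ?; cbv beta : par.
#[local] Hint Extern 1 (par2 _) => intros ? ? ? ? ? ? ?; cbv beta : par.

(** Relatedness is preserved by every connective and every defined notion, so proof search along the
    shape of a formula establishes parametricity. *)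
Ltac prm := solve [auto 60 with par nocore].

Lemma crel_cls l A : crel l (cls A) (cls A).
Proof.
  intros k. generalize (lupn k l); clear. intros l t t' (_ & _ & H). red.
  unfold cls. rewrite !fapp1E, ren_ren. apply ren_ext.
  intros [|i]; [exact H | symmetry; apply lfix].
Qed.

Lemma frel_fapp1 l A t t' : trel l t t' -> frel l (fapp A [t]) (fapp A [t']).
Proof. apply (crel_cls l A 0). Qed.

Lemma frel_fapp2 l A t t' u u' : trel l t t' -> trel l u u' ->
  frel l (fapp A [t; u]) (fapp A [t'; u']).
Proof.
  intros (_ & _ & Ht) (_ & _ & Hu). red. rewrite !fapp2E, ren_ren.
  apply ren_ext. intros [|[|i]]; [exact Ht | exact Hu | symmetry; apply lfix].
Qed.
#[local] Hint Resolve frel_fapp1 frel_fapp2 : par.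

Lemma crel_elts l t t' : trel l t t' -> crel l (elts t) (elts t').
Proof. unfold elts; prm. Qed.
#[local] Hint Resolve crel_cls crel_elts : par.

Ltac prm_unfold f := intros; unfold f; prm.

Lemma frel_sub_class l X X' Y Y' :
  crel l X X' -> crel l Y Y' -> frel l (sub_class X Y) (sub_class X' Y').
Proof. prm_unfold sub_class. Qed.

Lemma frel_is_set_of l s s' X X' :
  trel l s s' -> crel l X X' -> frel l (is_set_of s X) (is_set_of s' X').
Proof. prm_unfold is_set_of. Qed.

Lemma frel_subset l s s' t t' :
  trel l s s' -> trel l t t' -> frel l (subset s t) (subset s' t').
Proof. prm_unfold subset. Qed.
#[local] Hint Resolve frel_sub_class frel_is_set_of frel_subset : par.

Lemma frel_is_set l X X' : crel l X X' -> frel l (is_set X) (is_set X').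
Proof. prm_unfold is_set. Qed.

Lemma frel_Pow l X X' t t' :
  crel l X X' -> trel l t t' -> frel l (Pow X t) (Pow X' t').
Proof. prm_unfold Pow. Qed.

Lemma frel_is_upair l w w' x x' y y' : trel l w w' -> trel l x x' -> trel l y y' ->
  frel l (is_upair w x y) (is_upair w' x' y').
Proof. prm_unfold is_upair. Qed.
#[local] Hint Resolve frel_is_set frel_Pow frel_is_upair : par.

Lemma frel_is_pair l z z' x x' y y' : trel l z z' -> trel l x x' -> trel l y y' ->
  frel l (is_pair z x y) (is_pair z' x' y').
Proof. prm_unfold is_pair. Qed.
#[local] Hint Resolve frel_is_pair : par.

Lemma crel_holds l R R' x x' : crel l R R' -> trel l x x' ->
  crel l (holds R x) (holds R' x').
Proof. prm_unfold holds. Qed.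

Lemma frel_sub_prod l R R' X X' Y Y' : crel l R R' -> crel l X X' -> crel l Y Y' ->
  frel l (sub_prod R X Y) (sub_prod R' X' Y').
Proof. prm_unfold sub_prod. Qed.
#[local] Hint Resolve crel_holds frel_sub_prod : par.

Lemma frel_is_function l R R' X X' Y Y' : crel l R R' -> crel l X X' -> crel l Y Y' ->
  frel l (is_function R X Y) (is_function R' X' Y').
Proof. prm_unfold is_function. Qed.

Lemma frel_weakly_regular l c c' :
  trel l c c' -> frel l (weakly_regular c) (weakly_regular c').
Proof. prm_unfold weakly_regular. Qed.
#[local] Hint Resolve frel_is_function frel_weakly_regular : par.

Lemma frel_is_sup l L L' le le' U U' x x' :
  crel l L L' -> crel l le le' -> trel l U U' -> trel l x x' ->
  frel l (is_sup L le U x) (is_sup L' le' U' x').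
Proof. prm_unfold is_sup. Qed.

Lemma crel_down l le le' B B' x x' :
  crel l le le' -> trel l B B' -> trel l x x' ->
  crel l (down le B x) (down le' B' x').
Proof. prm_unfold down. Qed.
#[local] Hint Resolve frel_is_sup crel_down : par.

Lemma par_app X l t t' : par X -> trel l t t' -> frel l (X t) (X t').
Proof. auto. Qed.

Lemma par2_app X l t t' u u' :
  par2 X -> trel l t t' -> trel l u u' -> frel l (X t u) (X t' u').
Proof. auto. Qed.

Lemma par2_crel X l t t' : par2 X -> trel l t t' -> crel l (X t) (X t').
Proof. intros H Ht k u u' Hu. apply H; prm. Qed.

#[local] Hint Extern 1 (frel _ (?X _) (?X _)) => is_var X; apply par_app : par.
#[local] Hint Extern 1 (frel _ (?X _ _) (?X _ _)) => is_var X; apply par2_app : par.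
#[local] Hint Extern 1 (crel _ (?X _) (?X _)) => is_var X; apply par2_crel : par.
#[local] Hint Extern 1 (crel _ ?X ?X) => is_var X; apply par_crel : par.

Lemma frel_Phi_closed l L L' le le' B B' Phi Phi' Y Y' :
  crel l L L' -> crel l le le' -> trel l B B' -> crel l Phi Phi' -> crel l Y Y' ->
  frel l (Phi_closed L le B Phi Y) (Phi_closed L' le' B' Phi' Y').
Proof. intros; unfold Phi_closed, c_closed; prm. Qed.
#[local] Hint Resolve frel_Phi_closed : par.

Lemma frel_is_Gamma_of l L L' le le' B B' Phi Phi' a a' y y' :
  crel l L L' -> crel l le le' -> trel l B B' -> crel l Phi Phi' ->
  trel l a a' -> trel l y y' ->
  frel l (is_Gamma_of L le B Phi a y) (is_Gamma_of L' le' B' Phi' a' y').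
Proof. prm_unfold is_Gamma_of. Qed.

Lemma frel_surjection l f f' x x' s s' : trel l f f' -> trel l x x' -> trel l s s' ->
  frel l (surjection f x s) (surjection f' x' s').
Proof. prm_unfold surjection. Qed.
#[local] Hint Resolve frel_is_Gamma_of frel_surjection : par.

Lemma frel_is_bound l le le' B B' Phi Phi' a a' :
  crel l le le' -> trel l B B' -> crel l Phi Phi' -> trel l a a' ->
  frel l (is_bound le B Phi a) (is_bound le' B' Phi' a').
Proof. prm_unfold is_bound. Qed.
#[local] Hint Resolve frel_is_bound : par.

Lemma frel_least_fixed_point l L L' le le' F F' p p' :
  crel l L L' -> crel l le le' -> crel l F F' -> trel l p p' ->
  frel l (least_fixed_point L le F p) (least_fixed_point L' le' F' p').
Proof. prm_unfold least_fixed_point. Qed.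
#[local] Hint Resolve frel_least_fixed_point : par.

(** The body that [fAll] and [fEx] put under their binder at depth 0, with the argument as variable
    0. *)
Definition open_var (P : class) : form := P (fun e => e - 1) 1.
(** The first argument becomes variable 0 and the second variable 1, the order in which [fapp A
    [x; y]] fills them. *)
Definition open_var2 (P : tm -> class) : form :=
  P (fun e => e - 2) (fun e => e - 1) 2.

(** Instantiation of variable 0 is itself a renaming from depth 1 to depth 0 that fixes the free
    variables, so parametricity applies to it. *)
Lemma inst_level (x : nat) :
  { l | trel l (fun e => e - 1) (fv x) /\ ldom l = 1 /\ lcod l = 0 /\
        lren l = fun i => match i with 0 => x | S j => j end }.
Proof.
  exists (Level (fun i => match i with 0 => x | S j => j end) 1 0
            (fun j => eq_refl)).
  repeat split; simpl; unfold fv; intros; lia.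
Qed.

Lemma inst_open (P : class) x : par P -> inst x (open_var P) = P (fv x) 0.
Proof.
  intros H. destruct (inst_level x) as (l & Hl & E1 & E2 & E3).
  specialize (H l _ _ Hl). red in H. rewrite E1, E2, E3 in H.
  symmetry; exact H.
Qed.

Lemma fapp_open (P : class) x : par P -> fapp (open_var P) [fv x] 0 = P (fv x) 0.
Proof.
  intros H. rewrite <- inst_open by exact H. rewrite fapp1E.
  apply ren_ext. intros [|i]; reflexivity.
Qed.

Lemma fapp_open2 (P : tm -> class) x y : par2 P ->
  fapp (open_var2 P) [fv x; fv y] 0 = P (fv x) (fv y) 0.
Proof.
  intros H.
  pose (l := Level (fun i => match i with 0 => x | 1 => y | S (S j) => j end) 2 0
            (fun j => eq_refl)).
  specialize (H l (fun e => e - 2) (fv x) (fun e => e - 1) (fv y)).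
  unfold open_var2. rewrite fapp2E. symmetry. refine (eq_trans (H _ _) _).
  - repeat split; simpl; unfold fv; intros; lia.
  - repeat split; simpl; unfold fv; intros; lia.
  - reflexivity.
Qed.

(** * Derived rules with Rocq variables as eigenvariables *)

Definition prv (G : list form) (P : fm) : Prop := deriv CZF_wREA G (P 0).

Notation "G ⊢ P" := (prv G P%fm) (at level 98, P at level 97, no associativity).

Lemma prv_weak G G' P : incl G G' -> G ⊢ P -> G' ⊢ P.
Proof. intros H D. exact (deriv_weak _ _ D _ H). Qed.

Lemma imp_i G P Q : (forall G', incl G G' -> G' ⊢ P -> G' ⊢ Q) -> G ⊢ P ⟶ Q.
Proof.
  intros H. apply d_impI. apply H; [apply incl_tl, incl_refl | apply d_hyp, in_eq].
Qed.

Lemma imp_e G P Q : G ⊢ P ⟶ Q -> G ⊢ P -> G ⊢ Q.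
Proof. apply d_impE. Qed.

Lemma and_i G P Q : G ⊢ P -> G ⊢ Q -> G ⊢ P ∧ Q.
Proof. apply d_andI. Qed.

Lemma and_l G P Q : G ⊢ P ∧ Q -> G ⊢ P.
Proof. apply d_andEl. Qed.

Lemma and_r G P Q : G ⊢ P ∧ Q -> G ⊢ Q.
Proof. apply d_andEr. Qed.

Lemma or_l G P Q : G ⊢ P -> G ⊢ P ∨ Q.
Proof. apply d_orIl. Qed.

Lemma or_r G P Q : G ⊢ Q -> G ⊢ P ∨ Q.
Proof. apply d_orIr. Qed.

Lemma or_e G P Q R : G ⊢ P ∨ Q ->
  (forall G', incl G G' -> G' ⊢ P -> G' ⊢ R) ->
  (forall G', incl G G' -> G' ⊢ Q -> G' ⊢ R) -> G ⊢ R.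
Proof.
  intros D H1 H2. apply (d_orE _ _ _ _ _ D);
    [apply H1 | apply H2]; (apply incl_tl, incl_refl) || apply d_hyp, in_eq.
Qed.

Lemma all_i G Q : par Q -> (forall x : nat, G ⊢ Q (fv x)) -> G ⊢ fAll Q.
Proof.
  intros HQ H. apply deriv_all. intros x.
  change (deriv CZF_wREA G (inst x (open_var Q))). rewrite inst_open by exact HQ.
  apply H.
Qed.

Lemma all_e G Q (x : nat) : par Q -> G ⊢ fAll Q -> G ⊢ Q (fv x).
Proof.
  intros HQ H. red. rewrite <- inst_open by exact HQ. apply d_allE. exact H.
Qed.

Lemma ex_i G Q (x : nat) : par Q -> G ⊢ Q (fv x) -> G ⊢ fEx Q.
Proof.
  intros HQ H. apply d_exI with x.
  change (deriv CZF_wREA G (inst x (open_var Q))). rewrite inst_open by exact HQ.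
  exact H.
Qed.

Lemma ex_e G Q R : par Q -> G ⊢ fEx Q ->
  (forall G' (x : nat), incl G G' -> G' ⊢ Q (fv x) -> G' ⊢ R) -> G ⊢ R.
Proof.
  intros HQ D H. apply (deriv_ex _ _ _ D). intros x.
  change (deriv CZF_wREA (inst x (open_var Q) :: G) (R 0)).
  rewrite inst_open by exact HQ.
  apply (H _ x); [apply incl_tl, incl_refl | apply d_hyp, in_eq].
Qed.

Lemma eq_i G (x : nat) : G ⊢ fv x ≐ fv x.
Proof. apply d_eqI. Qed.

Lemma eq_e Q G (x y : nat) : par Q -> G ⊢ fv x ≐ fv y -> G ⊢ Q (fv x) -> G ⊢ Q (fv y).
Proof.
  unfold prv. intros HQ D. rewrite <- !inst_open by exact HQ. apply d_eqE, D.
Qed.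

Lemma eq_s G (x y : nat) : G ⊢ fv x ≐ fv y -> G ⊢ fv y ≐ fv x.
Proof. intros H. apply (eq_e (fun z => z ≐ fv x)) with x; [prm | exact H | apply eq_i]. Qed.

Lemma cut_imp G P Q (R : Prop) : G ⊢ P ⟶ Q -> G ⊢ P -> (G ⊢ Q -> R) -> R.
Proof. intros H1 H2 H3. exact (H3 (imp_e _ _ _ H1 H2)). Qed.

(** * Tactics for reasoning inside the theory *)

Ltac head_of P := lazymatch P with ?f _ => head_of f | _ => P end.

Ltac pack H x :=
  match type of H with ?T =>
    match eval pattern x in T with ?F _ =>
      let H' := fresh in
      pose proof (ex_intro F x H) as H'; cbv beta in H'; clear H; clear x;
      rename H' into H
    end
  end.

(** Weakening carried out beneath Rocq-level existentials and conjunctions, so that hypotheses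
    already taken apart survive an extension of the context. *)
Ltac shift_hyp i G G' H :=
  lazymatch type of H with
  | prv _ _ => apply (prv_weak G G' _ i) in H
  | ex _ =>
      let x := fresh in destruct H as [x H]; shift_hyp i G G' H; pack H x
  | _ /\ _ =>
      let H1 := fresh in let H2 := fresh in
      destruct H as [H1 H2]; shift_hyp i G G' H1; shift_hyp i G G' H2;
      pose proof (conj H1 H2) as H; clear H1 H2
  end.

Ltac shift i :=
  match type of i with
  | incl ?G ?G' =>
    repeat match goal with
    | H : context [prv G _] |- _ => shift_hyp i G G' H
    end;
    clear i; try (clear G; rename G' into G)
  end.

Ltac unfold_head :=
  lazymatch goal with |- prv _ ?P => let h := head_of P in unfold h end; cbv beta.
Ltac unfold_head_in H :=
  lazymatch type of H with
  | prv _ ?P => let h := head_of P in unfold h in H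
  end; cbv beta in H.

Ltac kintro x :=
  lazymatch goal with
  | |- prv _ (fAll _) => apply all_i; [prm | intros x; cbv beta]
  | |- prv _ (fImp _ _) =>
      apply imp_i; let G' := fresh "G" in let i := fresh "i" in
      intros G' i x; shift i
  | _ => unfold_head; kintro x
  end.

(* Turns [H] into a Rocq-level existential and conjunction of judgements, in an
   extended context. *)
Ltac knorm H :=
  lazymatch type of H with
  | prv ?G (fEx ?Q) =>
      simple refine (ex_e G Q _ _ H _); [prm|];
      let G' := fresh "G" in let i := fresh "i" in let x := fresh "x" in
      clear H; intros G' x i H; cbv beta in H; shift i; knorm H;
      pack H x
  | prv _ (fAnd _ _) =>
      let H1 := fresh in let H2 := fresh in
      pose proof (and_l _ _ _ H) as H1; pose proof (and_r _ _ _ H) as H2;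
      clear H; knorm H1; knorm H2; pose proof (conj H1 H2) as H; clear H1 H2
  | _ => idtac
  end.

Ltac kopen H :=
  lazymatch type of H with
  | prv _ (fEx _) => idtac
  | prv _ (fAnd _ _) => idtac
  | prv _ _ => unfold_head_in H; kopen H
  | _ => idtac
  end.

Tactic Notation "kd" hyp(H) "as" simple_intropattern(p) :=
  kopen H; knorm H; destruct H as p.

Tactic Notation "kor" hyp(H) :=
  let G1 := fresh "G" in let i1 := fresh "i" in
  let G2 := fresh "G" in let i2 := fresh "i" in
  apply (or_e _ _ _ _ H); clear H; [intros G1 i1 H; shift i1 | intros G2 i2 H; shift i2].

(* [args] is a tuple of variables and of derivations of the premises. *)
Ltac kinst H args :=
  lazymatch args with
  | (?a, ?b) => kinst H a; kinst H b
  | ?a =>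
    lazymatch type of H with
    | prv ?G (fAll ?Q) =>
        apply (all_e G Q a ltac:(prm)) in H; cbv beta in H
    | prv _ (fImp _ _) => apply (fun h => imp_e _ _ _ h a) in H
    | _ => unfold_head_in H; kinst H args
    end
  end.

Tactic Notation "khave" ident(H') ":=" constr(H) constr(args) :=
  pose proof H as H'; kinst H' args.

(** Backchaining: quantifiers are instantiated with unification variables, premises of implications
    become goals, and defined notions are unfolded on the way. *)
Ltac kapply H :=
  tryif exact H then idtac else
  lazymatch type of H with
  | prv ?G (fAll ?Q) =>
      let x := fresh in let H' := fresh in
      evar (x : nat); pose proof (all_e G Q x ltac:(prm) H) as H'; subst x;
      cbv beta in H'; kapply H'; clear H'
  | prv _ (fImp _ _) =>
      let H' := fresh in
      simple refine (cut_imp _ _ _ _ H _ _);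
      [ | intros H'; kapply H'; clear H']
  | prv _ (fAnd _ _) => first [kapply (and_l _ _ _ H) | kapply (and_r _ _ _ H)]
  | prv _ ?P =>
      let h := head_of P in
      let H' := fresh in pose proof H as H'; unfold h in H'; cbv beta in H';
      kapply H'; clear H'
  end.

Ltac kexists x :=
  lazymatch goal with
  | |- prv _ (fEx _) => apply (ex_i _ _ x); [prm | cbv beta]
  | _ => unfold_head; kexists x
  end.

Ltac ksplit :=
  lazymatch goal with
  | |- prv _ (fAnd _ _) => apply and_i
  | _ => unfold_head; ksplit
  end.

Ltac krew H :=
  lazymatch type of H with
  | prv ?G (fEq (fv ?x) (fv ?y)) =>
    repeat match goal with
    | H' : prv G ?P |- _ =>
      lazymatch H' with H => fail | _ => idtac end;
      lazymatch P with context [fv x] => idtac end;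
      lazymatch eval pattern (fv x) in P with
      | ?Q _ => apply (eq_e Q G x y ltac:(prm) H) in H'; cbv beta in H'
      end
    end;
    lazymatch goal with
    | |- prv G ?P =>
      lazymatch eval pattern (fv x) in P with
      | ?Q _ => apply (eq_e Q G y x ltac:(prm) (eq_s _ _ _ H)); cbv beta
      end
    end;
    clear H
  end.

Tactic Notation "kintros" ident(a) := kintro a.
Tactic Notation "kintros" ident(a) ident(b) := kintro a; kintro b.
Tactic Notation "kintros" ident(a) ident(b) ident(c) := kintro a; kintro b; kintro c.
Tactic Notation "kintros" ident(a) ident(b) ident(c) ident(d) :=
  kintro a; kintro b; kintro c; kintro d.
Tactic Notation "kintros" ident(a) ident(b) ident(c) ident(d) ident(e) :=
  kintro a; kintro b; kintro c; kintro d; kintro e.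


(** * Set theory *)

#[local] Coercion fv : nat >-> tm.

Lemma ext_ax G (a b : nat) : G ⊢ (∀ x, x ∈ a ⟷ x ∈ b) -> G ⊢ a ≐ b.
Proof.
  intros H.
  assert (E : G ⊢ ∀ a, ∀ b, (∀ x, x ∈ a ⟷ x ∈ b) ⟶ a ≐ b)
    by apply d_ax, extensionality.
  kapply E. exact H.
Qed.

Lemma ext_sub G (a b : nat) : G ⊢ subset a b -> G ⊢ subset b a -> G ⊢ a ≐ b.
Proof.
  intros H1 H2. apply ext_ax. kintro x. ksplit; [kapply H1 | kapply H2].
Qed.

Lemma pair_ax G (a b : nat) : G ⊢ ∃ c, ∀ x, x ∈ c ⟷ x ≐ a ∨ x ≐ b.
Proof.
  assert (E : G ⊢ ∀ a, ∀ b, ∃ c, ∀ x, x ∈ c ⟷ x ≐ a ∨ x ≐ b)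
    by apply d_ax, pairing.
  kapply E.
Qed.

Lemma union_ax G (a : nat) : G ⊢ ∃ c, ∀ x, x ∈ c ⟷ (∃ y ∈ a, x ∈ y).
Proof.
  assert (E : G ⊢ ∀ a, ∃ c, ∀ x, x ∈ c ⟷ (∃ y ∈ a, x ∈ y)) by apply d_ax, union.
  kapply E.
Qed.

Lemma wREA_ax G (a : nat) : G ⊢ ∃ c, subset a c ∧ weakly_regular c.
Proof.
  assert (E : G ⊢ ∀ a, ∃ c, subset a c ∧ weakly_regular c) by apply d_ax, wREA.
  kapply E.
Qed.

Lemma prv_eq G P Q : P 0 = Q 0 -> G ⊢ P -> G ⊢ Q.
Proof. unfold prv. congruence. Qed.

(** The scheme is about formulas; a parametric class is represented by [open_var P], and [fapp_open]
    translates in both directions. *)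
Lemma set_ind (P : class) G : par P ->
  G ⊢ (∀ a, (∀ x ∈ a, P x) ⟶ P a) -> G ⊢ ∀ a, P a.
Proof.
  intros HP H.
  assert (E : G ⊢ (∀ a, (∀ x ∈ a, fapp (open_var P) [x]) ⟶ fapp (open_var P) [a])
                  ⟶ ∀ a, fapp (open_var P) [a])
    by apply d_ax, set_induction.
  apply (cut_imp _ _ _ _ E); clear E.
  - kintros a IH. apply (prv_eq _ (P a)); [symmetry; apply fapp_open, HP|].
    kapply H. kintros x Hx. kinst IH (x, Hx).
    apply prv_eq with (2 := IH). apply fapp_open, HP.
  - intros E. kintro a. kinst E a.
    apply prv_eq with (2 := E). apply fapp_open, HP.
Qed.

Lemma collection (P : tm -> class) G (a : nat) : par2 P ->
  G ⊢ (∀ x ∈ a, ∃ y, P x y) ->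
  G ⊢ ∃ b, (∀ x ∈ a, ∃ y ∈ b, P x y) ∧ (∀ y ∈ b, ∃ x ∈ a, P x y).
Proof.
  intros HP H.
  assert (E : let A := open_var2 P in G ⊢ ∀ a, (∀ x ∈ a, ∃ y, fapp A [x; y]) ⟶
      ∃ b, (∀ x ∈ a, ∃ y ∈ b, fapp A [x; y]) ∧
           (∀ y ∈ b, ∃ x ∈ a, fapp A [x; y]))
    by apply d_ax, strong_collection.
  cbv zeta in E. kinst E a. apply (cut_imp _ _ _ _ E); clear E.
  - kintros x Hx. kinst H (x, Hx). kd H as [y Hy]. kexists y.
    apply prv_eq with (2 := Hy). symmetry. apply fapp_open2, HP.
  - intros E. kd E as [b [E1 E2]]. kexists b. ksplit.
    + kintros x Hx. kinst E1 (x, Hx). kd E1 as [y [Hy E1]]. kexists y.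
      ksplit; [exact Hy|]. apply prv_eq with (2 := E1). apply fapp_open2, HP.
    + kintros y Hy. kinst E2 (y, Hy). kd E2 as [x [Hx E2]]. kexists x.
      ksplit; [exact Hx|]. apply prv_eq with (2 := E2). apply fapp_open2, HP.
Qed.

Lemma binary_union G (a b : nat) : G ⊢ ∃ c, ∀ x, x ∈ c ⟷ x ∈ a ∨ x ∈ b.
Proof.
  pose proof (pair_ax G a b) as H. kd H as [p Hp].
  pose proof (union_ax G p) as H. kd H as [c Hc].
  kexists c. kintro x. ksplit.
  - kintro H. kinst Hc x. kd Hc as [Hc _]. kinst Hc H. kd Hc as [y [Hy Hx]].
    kinst Hp y. kd Hp as [Hp _]. kinst Hp Hy. kor Hp.
    + krew Hp. apply or_l, Hx.
    + krew Hp. apply or_r, Hx.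
  - kintro H. kapply Hc. kor H.
    + kexists a. ksplit; [|exact H]. kapply Hp. apply or_l, eq_i.
    + kexists b. ksplit; [|exact H]. kapply Hp. apply or_r, eq_i.
Qed.

Lemma upair_exists G (x y : nat) : G ⊢ ∃ w, is_upair w x y.
Proof.
  pose proof (pair_ax G x y) as H. kd H as [w Hw]. kexists w.
  ksplit; [|ksplit].
  - kapply Hw. apply or_l, eq_i.
  - kapply Hw. apply or_r, eq_i.
  - kintros v Hv. kinst Hw v. kapply (and_l _ _ _ Hw). exact Hv.
Qed.

Lemma pair_exists G (x y : nat) : G ⊢ ∃ z, is_pair z x y.
Proof.
  pose proof (upair_exists G x x) as H1. pose proof (upair_exists G x y) as H2.
  kd H1 as [w1 H1].
  kd H2 as [w2 H2]. pose proof (upair_exists G w1 w2) as H.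
  kd H as [z H]. kd H as (Hz1 & Hz2 & Hz). kexists z. ksplit; [|ksplit].
  - kexists w1. ksplit; assumption.
  - kexists w2. ksplit; assumption.
  - kintros w Hw. kinst Hz (w, Hw). kor Hz; krew Hz; [apply or_l | apply or_r]; assumption.
Qed.

Lemma upair_l G (w x y : nat) : G ⊢ is_upair w x y -> G ⊢ x ∈ w.
Proof. apply and_l. Qed.

Lemma upair_r G (w x y : nat) : G ⊢ is_upair w x y -> G ⊢ y ∈ w.
Proof. intros H. exact (and_l _ _ _ (and_r _ _ _ H)). Qed.

Lemma upair_mem G (w x y v : nat) :
  G ⊢ is_upair w x y -> G ⊢ v ∈ w -> G ⊢ v ≐ x ∨ v ≐ y.
Proof. intros H Hv. kd H as (_ & _ & H). kinst H (v, Hv). exact H. Qed.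

Lemma upair_diag G (w x v : nat) : G ⊢ is_upair w x x -> G ⊢ v ∈ w -> G ⊢ v ≐ x.
Proof. intros H Hv. pose proof (upair_mem _ _ _ _ _ H Hv) as E. kor E; exact E. Qed.

Lemma eq_t G (x y z : nat) : G ⊢ x ≐ y -> G ⊢ y ≐ z -> G ⊢ x ≐ z.
Proof. intros H1 H2. krew H1. exact H2. Qed.

Lemma pair_inj_l G (z x y x' y' : nat) :
  G ⊢ is_pair z x y -> G ⊢ is_pair z x' y' -> G ⊢ x ≐ x'.
Proof.
  intros H H'. kd H as ([w [Hw H1]] & _ & _). kd H' as (_ & _ & H').
  kinst H' (w, Hw). apply eq_s. kor H'; eapply upair_diag;
    try eassumption; eapply upair_l; eassumption.
Qed.

Lemma pair_snd G (z x y x' y' : nat) :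
  G ⊢ is_pair z x y -> G ⊢ is_pair z x' y' -> G ⊢ y ≐ x' ∨ y ≐ y'.
Proof.
  intros H H'. kd H as (_ & [w [Hw H1]] & _). kd H' as (_ & _ & H').
  kinst H' (w, Hw). pose proof (upair_r _ _ _ _ H1). kor H'.
  - apply or_l. eapply upair_diag; eassumption.
  - eapply upair_mem; eassumption.
Qed.

Lemma pair_inj_r G (z x y x' y' : nat) :
  G ⊢ is_pair z x y -> G ⊢ is_pair z x' y' -> G ⊢ y ≐ y'.
Proof.
  intros H H'. pose proof (pair_inj_l _ _ _ _ _ _ H H') as E.
  pose proof (pair_snd _ _ _ _ _ _ H H') as E1.
  pose proof (pair_snd _ _ _ _ _ _ H' H) as E2.
  kor E1; [|exact E1]. kor E2; [|apply eq_s; exact E2].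
  apply (eq_t _ _ x'); [exact E1|]. apply eq_s, (eq_t _ _ x); assumption.
Qed.

(* Strong collection replaces the formula by a set of pairs, to which weak
   regularity applies. *)
Lemma weakly_regular_rel (P : tm -> class) G (c u : nat) : par2 P ->
  G ⊢ weakly_regular c -> G ⊢ u ∈ c -> G ⊢ (∀ x ∈ u, ∃ y ∈ c, P x y) ->
  G ⊢ ∃ v ∈ c, ∀ x ∈ u, ∃ y ∈ v, P x y.
Proof.
  intros HP Hc Hu H.
  assert (E : G ⊢ ∀ x ∈ u, ∃ z, ∃ y, y ∈ c ∧ P x y ∧ is_pair z x y).
  { kintros x Hx. kinst H (x, Hx). kd H as [y [Hy HP1]].
    pose proof (pair_exists G x y) as Hz. kd Hz as [z Hz].
    kexists z. kexists y. ksplit; [|ksplit]; assumption. }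
  apply (collection (fun x z => ∃ y, y ∈ c ∧ P x y ∧ is_pair z x y)) in E; [|prm].
  kd E as [R [E1 E2]].
  kd Hc as (_ & _ & Hc). kinst Hc (u, Hu, R).
  apply (cut_imp _ _ _ _ Hc); clear Hc.
  { kintros z Hz. kinst E2 (z, Hz). kd E2 as [x [Hx [y [Hy [HP1 Hp]]]]].
    kexists x. kexists y. ksplit; [|ksplit]; assumption. }
  intros Hc. apply (cut_imp _ _ _ _ Hc); clear Hc.
  { kintros x Hx. kinst E1 (x, Hx). kd E1 as [z [Hz [y [Hy [HP1 Hp]]]]].
    kexists y. kexists z. ksplit; assumption. }
  intros Hc. kd Hc as [v [Hv Hc]]. kexists v. ksplit; [exact Hv|].
  kintros x Hx. kinst Hc (x, Hx). kd Hc as [y [Hy Hc]]. kexists y.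
  ksplit; [exact Hy|]. kd Hc as [z [Hp Hz]].
  (* The second half of Strong Collection says that [R] has no other members than pairs satisfying
     [P]; injectivity of pairing then identifies the components. *)
  kinst E2 (z, Hz). kd E2 as [x' [Hx' [y' [Hy' [HP1 Hp']]]]].
  pose proof (pair_inj_l _ _ _ _ _ _ Hp' Hp) as Ex.
  pose proof (pair_inj_r _ _ _ _ _ _ Hp' Hp) as Ey.
  krew Ex. krew Ey. exact HP1.
Qed.

(** Strong Collection gathers sets representing the classes [X x]; its second half ensures that
    nothing else is gathered, so their union is exact. *)
Lemma union_of_sets (X : tm -> class) G (a : nat) : par2 X ->
  G ⊢ (∀ x ∈ a, is_set (X x)) ->
  G ⊢ ∃ V, ∀ b, b ∈ V ⟷ (∃ x ∈ a, X x b).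
Proof.
  intros HX H.
  apply (collection (fun x s => is_set_of s (X x))) in H; [|prm].
  kd H as [c [H1 H2]]. pose proof (union_ax G c) as H. kd H as [V HV].
  kexists V. kintro b. kinst HV b. kd HV as [HV1 HV2]. ksplit; kintro Hb.
  - kinst HV1 Hb. kd HV1 as [s [Hs HV1]]. kinst H2 (s, Hs).
    kd H2 as [x [Hx H2]]. kexists x. ksplit; [exact Hx|]. kapply H2. exact HV1.
  - kapply HV2. kd Hb as [x [Hx Hb]]. kinst H1 (x, Hx). kd H1 as [s [Hs H1]].
    kexists s. ksplit; [exact Hs|]. kapply H1. exact Hb.
Qed.

Lemma sub_prod_l R X Y G (x y : nat) : par R -> par X -> par Y ->
  G ⊢ sub_prod R X Y -> G ⊢ holds R x y -> G ⊢ X x.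
Proof.
  intros HR HX HY H Hz. kd Hz as (z & Hp & Hz). kinst H (z, Hz).
  kd H as (x' & y' & H1 & _ & Hp').
  pose proof (pair_inj_l _ _ _ _ _ _ Hp' Hp) as E. krew E. exact H1.
Qed.

Lemma sub_prod_r R X Y G (x y : nat) : par R -> par X -> par Y ->
  G ⊢ sub_prod R X Y -> G ⊢ holds R x y -> G ⊢ Y y.
Proof.
  intros HR HX HY H Hz. kd Hz as (z & Hp & Hz). kinst H (z, Hz).
  kd H as (x' & y' & _ & H1 & Hp').
  pose proof (pair_inj_r _ _ _ _ _ _ Hp' Hp) as E. krew E. exact H1.
Qed.

Lemma par_cls A : par (cls A).
Proof. intros l. apply (crel_cls l A 0). Qed.

Lemma par_elts (s : nat) : par (elts s).
Proof. prm_unfold elts. Qed.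

(** Lets a class built from named binders be presented as the class of a single formula. *)
Lemma cls_open P G : par P -> G ⊢ ∀ x, cls (open_var P) x ⟷ P x.
Proof.
  intros HP. pose proof (fun x => fapp_open P x HP) as E. unfold cls.
  kintro x. ksplit; kintro H; apply prv_eq with (2 := H); [|symmetry]; apply E.
Qed.

Lemma Phi_closed_ext L le (B : nat) Phi X Y G :
  par L -> par le -> par Phi -> par X -> par Y -> G ⊢ (∀ x, X x ⟷ Y x) ->
  G ⊢ Phi_closed L le B Phi Y -> G ⊢ Phi_closed L le B Phi X.
Proof.
  intros HL Hle HPhi HX HY E HC. kd HC as (H1 & H2 & H3).
  ksplit; [|ksplit].
  - kintros b Hb. kapply H1. kapply E. exact Hb.
  - kintros U HU j Hj b. kintro Hb. kapply E. kinst H2 U.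
    apply (cut_imp _ _ _ _ H2); clear H2.
    + kintros u Hu. kapply E. kapply HU. exact Hu.
    + intros H2. kinst H2 (j, Hj, b, Hb). exact H2.
  - kintros b a Hba Hsub. kapply E. kinst H3 (b, a, Hba). kapply H3.
    kintros c Hc. kapply E. kapply Hsub. exact Hc.
Qed.

(** * Stages of the inductive definition *)

Section InductiveDefinition.

Variables (fL fle fD fGam fPhi : form) (kB : nat).

Local Notation L := (cls fL).
Local Notation le := (cls fle).
Local Notation D := (cls fD).
Local Notation Gam := (cls fGam).
Local Notation Phi := (cls fPhi).
Local Notation B := (fv kB).

Definition setting : fm :=
  set_presented L le B D ∧
  monotone_operator L le Gam ∧
  abstract_ind_def L B Phi ∧
  bounded L le B Phi ∧
  eq_Gamma_of L le B Phi Gam.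

(* The rules [b ≤ ⋁U] of c_L-closedness and the rules of [Phi], applied to a set
   [U] of elements of the stages [E y] with [y ∈ x]. *)
Definition step (E : tm -> class) (x b : tm) : fm :=
  b ∈ B ∧ ∃ U, (∀ u ∈ U, ∃ y ∈ x, E y u) ∧
    ∃ q, is_sup L le U q ∧ (holds le b q ∨ ∃ a, holds Phi b a ∧ holds le a q).

Definition sound (K : tm) : fm :=
  ∀ z ∈ K, ∃ x, ∃ b, is_pair z x b ∧ step (holds (elts K)) x b.

(* [J a] is the stage [a] of the inductive definition: [J a = step J a].  Defining it
   through post-fixed sets of pairs avoids transfinite recursion, since unions of
   sound sets are sound. *)
Definition J (a b : tm) : fm := ∃ K, sound K ∧ holds (elts K) a b.

Lemma frel_step l E E' x x' b b' :
  (forall k t t', trel (lupn k l) t t' -> crel (lupn k l) (E t) (E' t')) ->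
  trel l x x' -> trel l b b' -> frel l (step E x b) (step E' x' b').
Proof.
  (* In [step] the relation [E] occurs under the three binders for [U], [u] and [y]. *)
  intros HE Hx Hb. pose proof (HE 3) as H3. unfold step.
  simpl in H3; prm.
Qed.

#[local] Hint Resolve frel_step : par.

Lemma frel_sound l K K' : trel l K K' -> frel l (sound K) (sound K').
Proof. intros; unfold sound; prm. Qed.
#[local] Hint Resolve frel_sound : par.

Lemma crel_J l a a' : trel l a a' -> crel l (J a) (J a').
Proof. prm_unfold J. Qed.
#[local] Hint Resolve crel_J : par.

Lemma holds_elts_i G (K z x y : nat) :
  G ⊢ is_pair z x y -> G ⊢ z ∈ K -> G ⊢ holds (elts K) x y.
Proof. intros H1 H2. kexists z. ksplit; assumption. Qed.

Lemma step_mono G (K K' : nat) (x b : nat) : G ⊢ subset K K' ->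
  G ⊢ step (holds (elts K)) x b -> G ⊢ step (holds (elts K')) x b.
Proof.
  intros HK H. kd H as [Hb [U [HU [q [Hq H]]]]]. ksplit; [exact Hb|].
  kexists U. ksplit.
  - kintros u Hu. kinst HU (u, Hu). kd HU as [y [Hy HU]]. kd HU as [z [Hp Hz]].
    kexists y. ksplit; [exact Hy|].
    eapply holds_elts_i; [exact Hp|]. kapply HK. exact Hz.
  - kexists q. ksplit; assumption.
Qed.

(** Each pair is justified inside its own member of [c], and [step] is monotone in the relation. *)
Lemma sound_union G (c K : nat) : G ⊢ (∀ K' ∈ c, sound K') ->
  G ⊢ (∀ x, x ∈ K ⟷ (∃ y ∈ c, x ∈ y)) -> G ⊢ sound K.
Proof.
  intros Hc HK. kintros z Hz. khave H := HK z. kd H as [H _]. kinst H Hz.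
  kd H as [K' [HK' H]]. khave H' := Hc (K', HK'). kinst H' (z, H).
  kd H' as [x [b [Hp H']]]. kexists x. kexists b. ksplit; [exact Hp|].
  apply step_mono with K'; [|exact H'].
  kintros w Hw. kapply HK. kexists K'. ksplit; assumption.
Qed.

Lemma J_unfold G (a b : nat) : G ⊢ J a b -> G ⊢ step J a b.
Proof.
  intros H. kd H as [K [HK H]]. kd H as [z [Hp Hz]].
  khave H := HK (z, Hz). kd H as [a' [b' [Hp' H]]].
  pose proof (pair_inj_l _ _ _ _ _ _ Hp' Hp) as Ea.
  pose proof (pair_inj_r _ _ _ _ _ _ Hp' Hp) as Eb.
  unfold step in H. krew Ea. krew Eb.
  kd H as [Hb [U [HU [q [Hq H]]]]]. ksplit; [exact Hb|].
  kexists U. ksplit.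
  - kintros u Hu. kinst HU (u, Hu). kd HU as [y [Hy HU]].
    kexists y. ksplit; [exact Hy|]. kexists K. ksplit; assumption.
  - kexists q. ksplit; assumption.
Qed.

(** Strong Collection yields sound sets witnessing all premises [u ∈ U]. Their union is sound, and
    it stays sound after adding the pair [(a, b)], which the given rule justifies. *)
Lemma J_fold G (a b : nat) : G ⊢ step J a b -> G ⊢ J a b.
Proof.
  intros H. kd H as [Hb [U [HU [q [Hq H]]]]].
  assert (E : G ⊢ ∀ u ∈ U, ∃ K, sound K ∧ ∃ y ∈ a, holds (elts K) y u).
  { kintros u Hu. kinst HU (u, Hu). kd HU as [y [Hy HU]]. kd HU as [K [HK HU]].
    kexists K. ksplit; [exact HK|]. kexists y. ksplit; assumption. }
  apply (collection (fun u K => sound K ∧ ∃ y ∈ a, holds (elts K) y u)) in E; [|prm].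
  kd E as [c [E1 E2]].
  pose proof (union_ax G c) as H0. kd H0 as [K0 HK0].
  assert (S0 : G ⊢ sound K0).
  { apply sound_union with c; [|exact HK0]. kintros K HK. kinst E2 (K, HK).
    kd E2 as (u & _ & HS & _). exact HS. }
  pose proof (pair_exists G a b) as Hz. kd Hz as [z Hz].
  pose proof (pair_ax G z z) as Hs. kd Hs as [s Hs].
  pose proof (binary_union G K0 s) as HK1. kd HK1 as [K1 HK1].
  assert (Sub : G ⊢ subset K0 K1).
  { kintros w Hw. kapply HK1. apply or_l, Hw. }
  assert (HU1 : G ⊢ ∀ u ∈ U, ∃ y ∈ a, holds (elts K1) y u).
  { kintros u Hu. kinst E1 (u, Hu). kd E1 as (K & HK & _ & y & Hy & E1).
    kexists y. ksplit; [exact Hy|]. kd E1 as (w & Hw & Hw').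
    apply holds_elts_i with w; [exact Hw|]. kapply Sub. kapply HK0.
    kexists K. ksplit; assumption. }
  kexists K1. ksplit.
  - kintros w Hw. khave Hc := HK1 w. kd Hc as [Hc _]. kinst Hc Hw. kor Hc.
    + khave S1 := S0 (w, Hc). kd S1 as (x & b' & Hp & S1).
      kexists x. kexists b'. ksplit; [exact Hp|].
      apply step_mono with K0; assumption.
    + assert (Ew : G ⊢ w ≐ z).
      { kinst Hs w. kd Hs as [Hs _]. kinst Hs Hc. kor Hs; exact Hs. }
      krew Ew. kexists a. kexists b. ksplit; [exact Hz|].
      ksplit; [exact Hb|]. kexists U. ksplit; [exact HU1|].
      kexists q. ksplit; assumption.
  - apply holds_elts_i with z; [exact Hz|]. kapply HK1. apply or_r.
    kapply Hs. apply or_l, eq_i.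
Qed.

(** * Consequences of the hypotheses on the semilattice and the operator *)

Lemma le_refl G x : G ⊢ setting -> G ⊢ L (fv x) -> G ⊢ holds le x x.
Proof.
  intros H Hx. kd H as (H & _). kd H as (H & _). kd H as (H & _). kd H as (H & _).
  kd H as (_ & H & _). kapply H. exact Hx.
Qed.

Lemma le_trans G x y z : G ⊢ setting -> G ⊢ holds le (fv x) (fv y) ->
  G ⊢ holds le (fv y) (fv z) -> G ⊢ holds le x z.
Proof.
  intros H Hx Hy. kd H as (H & _). kd H as (H & _). kd H as (H & _). kd H as (H & _).
  kd H as (_ & _ & H & _). kinst H (x, y, z, Hx, Hy). exact H.
Qed.

Lemma le_antisym G x y : G ⊢ setting -> G ⊢ holds le (fv x) (fv y) ->
  G ⊢ holds le (fv y) (fv x) -> G ⊢ x ≐ y.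
Proof.
  intros H Hx Hy. kd H as (H & _). kd H as (H & _). kd H as (H & _). kd H as (H & _).
  kd H as (_ & _ & _ & H). kinst H (x, y, Hx, Hy). exact H.
Qed.

Lemma Phi_B G b a : G ⊢ setting -> G ⊢ holds Phi (fv b) (fv a) -> G ⊢ b ∈ B.
Proof.
  intros H Hb. kd H as (_ & _ & H & _).
  apply (sub_prod_l Phi (elts B) L G b a); auto using par_cls, par_elts.
Qed.

Lemma Phi_L G b a : G ⊢ setting -> G ⊢ holds Phi (fv b) (fv a) -> G ⊢ L a.
Proof.
  intros H Hb. kd H as (_ & _ & H & _).
  apply (sub_prod_r Phi (elts B) L G b a); auto using par_cls, par_elts.
Qed.

Lemma B_L G b : G ⊢ setting -> G ⊢ fv b ∈ B -> G ⊢ L b.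
Proof.
  intros H Hb. kd H as (H & _). kd H as (H & _). kd H as (_ & H & _).
  kinst H (b, Hb). exact H.
Qed.

Lemma sup_exists G U : G ⊢ setting -> G ⊢ subset (fv U) B -> G ⊢ ∃ x, is_sup L le U x.
Proof.
  intros H HU. assert (HUL : G ⊢ Pow L U).
  { kintros u Hu. kinst HU (u, Hu). apply B_L; assumption. }
  kd H as (H & _). kd H as (H & _). kd H as (H & _). kd H as (_ & H).
  kinst H (U, HUL). exact H.
Qed.

Lemma sup_L G U x : G ⊢ is_sup L le (fv U) (fv x) -> G ⊢ L x.
Proof. apply and_l. Qed.

Lemma sup_ub G U x u : G ⊢ is_sup L le (fv U) (fv x) -> G ⊢ fv u ∈ fv U ->
  G ⊢ holds le u x.
Proof. intros H Hu. kd H as (_ & H & _). kinst H (u, Hu). exact H. Qed.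

Lemma sup_lub G U x y : G ⊢ is_sup L le (fv U) (fv x) -> G ⊢ L (fv y) ->
  G ⊢ (∀ u ∈ U, holds le u y) -> G ⊢ holds le x y.
Proof. intros H Hy Hu. kd H as (_ & _ & H). kinst H (y, Hy, Hu). exact H. Qed.

Lemma generated G x : G ⊢ setting -> G ⊢ L (fv x) ->
  G ⊢ ∃ s, is_set_of s (down le B x) ∧ is_sup L le s x.
Proof.
  intros H Hx. kd H as (H & _). kd H as (H & _). kd H as (_ & _ & H).
  kinst H (x, Hx). exact H.
Qed.

Lemma below_le G x y : G ⊢ setting -> G ⊢ L (fv x) -> G ⊢ L (fv y) ->
  G ⊢ (∀ b, down le B x b ⟶ holds le b y) -> G ⊢ holds le x y.
Proof.
  intros H Hx Hy Hb. pose proof (generated _ _ H Hx) as Hs.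
  kd Hs as (s & Hs & Hsup). eapply sup_lub; [exact Hsup | exact Hy |].
  kintros u Hu. kapply Hb. kapply Hs. exact Hu.
Qed.

Lemma presented G b U : G ⊢ setting -> G ⊢ fv b ∈ B -> G ⊢ subset (fv U) B ->
  G ⊢ (∃ j, is_sup L le U j ∧ holds le b j) ⟷
      (∃ V, holds D b V ∧ ∃ W ∈ V, subset W U).
Proof.
  intros H Hb HU. kd H as (H & _). kd H as (_ & _ & H).
  kinst H (b, Hb, U, HU). exact H.
Qed.

Lemma Gam_value G a : G ⊢ setting -> G ⊢ L (fv a) ->
  G ⊢ ∃ y, holds Gam a y.
Proof.
  intros H Ha. kd H as (_ & H & _). kd H as (H & _). kd H as (_ & H & _).
  kinst H (a, Ha). exact H.
Qed.

Lemma Gam_is_Gamma G a y : G ⊢ setting -> G ⊢ L (fv a) -> G ⊢ holds Gam (fv a) (fv y) ->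
  G ⊢ is_Gamma_of L le B Phi a y.
Proof.
  intros H Ha Hy. kd H as (_ & _ & _ & _ & H). kinst H (a, Ha, y).
  kd H as (H & _). kinst H Hy. exact H.
Qed.

Lemma Gam_mono G a b c d : G ⊢ setting -> G ⊢ holds le (fv a) (fv b) ->
  G ⊢ holds Gam (fv a) (fv c) -> G ⊢ holds Gam (fv b) (fv d) -> G ⊢ holds le c d.
Proof.
  intros H H1 H2 H3. kd H as (_ & H & _). kd H as (_ & H).
  kinst H (a, b, c, d, H1, H2, H3). exact H.
Qed.

Lemma Gam_rule G a y a' b : G ⊢ setting -> G ⊢ L (fv a) -> G ⊢ holds Gam (fv a) (fv y) ->
  G ⊢ holds Phi (fv b) (fv a') -> G ⊢ holds le (fv a') (fv a) -> G ⊢ holds le b y.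
Proof.
  intros H Ha Hy Hb Ha'. pose proof (Gam_is_Gamma _ _ _ H Ha Hy) as HG.
  kd HG as (s & Hs & Hsup). eapply sup_ub; [exact Hsup|].
  kapply Hs. ksplit; [eapply Phi_B; eassumption|].
  kexists a'. ksplit; assumption.
Qed.

Lemma J_B G a b : G ⊢ J (fv a) (fv b) -> G ⊢ b ∈ B.
Proof. intros H. apply J_unfold in H. exact (and_l _ _ _ H). Qed.

(** Set induction on the stage: the earlier stages lie in [Y], so [c_L]-closedness puts [↓q] into
    [Y]; a rule with premise [a' ≤ q] then has [↓a' ⊆ ↓q ⊆ Y]. *)
Lemma J_least Y G : par Y -> G ⊢ setting -> G ⊢ Phi_closed L le B Phi Y ->
  G ⊢ ∀ a, ∀ b, J a b ⟶ Y b.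
Proof.
  intros HY H HC. apply (set_ind (fun a => ∀ b, J a b ⟶ Y b)); [prm|].
  kintros a IH b Hb. apply J_unfold in Hb. kd Hb as (Hb & U & HU & q & Hq & Hr).
  kd HC as (_ & HC & HP).
  assert (E : G ⊢ sub_class (down le B q) Y).
  { kinst HC U. apply (cut_imp _ _ _ _ HC); clear HC.
    - kintros u Hu. kinst HU (u, Hu). kd HU as (y & Hy & HU).
      kinst IH (y, Hy, u, HU). exact IH.
    - intros HC. kinst HC (q, Hq). exact HC. }
  kor Hr.
  - kapply E. ksplit; assumption.
  - kd Hr as (a' & Ha' & Hle). kinst HP (b, a', Ha'). kapply HP.
    kintros c Hc. kd Hc as (Hc & Hca). kapply E. ksplit; [exact Hc|].
    eapply le_trans; eassumption.
Qed.

(* [J a] is [↓q] together with the conclusions of the rules whose premise lies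
   below [q], where [q] is the join of the earlier stages. *)
Lemma J_set G : G ⊢ setting -> G ⊢ ∀ a, is_set (J a).
Proof.
  intros H. apply (set_ind (fun a => is_set (J a))); [prm|].
  kintros a IH.
  apply (union_of_sets J) in IH; [|intros ? **; prm].
  kd IH as (V & HV).
  assert (HVB : G ⊢ subset V B).
  { kintros u Hu. kinst HV u. kd HV as (HV & _). kinst HV Hu. kd HV as (x & _ & HV).
    eapply J_B, HV. }
  pose proof (sup_exists _ _ H HVB) as Hq. kd Hq as (q & Hq).
  pose proof (sup_L _ _ _ Hq) as HL.
  pose proof (generated _ _ H HL) as Hs. kd Hs as (s & Hs & _).
  pose proof (Gam_value _ _ H HL) as Hy. kd Hy as (y & Hy).
  pose proof (Gam_is_Gamma _ _ _ H HL Hy) as Ht. kd Ht as (t & Ht & _).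
  pose proof (binary_union G s t) as Hw. kd Hw as (w & Hw).
  kexists w. kintro b. kinst Hw b. kd Hw as (Hw1 & Hw2). ksplit; kintro Hb.
  - apply J_fold. kinst Hw1 Hb.
    assert (HbB : G ⊢ b ∈ B).
    { kor Hw1.
      - kinst Hs b. kd Hs as (Hs & _). kinst Hs Hw1. exact (and_l _ _ _ Hs).
      - kinst Ht b. kd Ht as (Ht & _). kinst Ht Hw1. exact (and_l _ _ _ Ht). }
    ksplit; [exact HbB|]. kexists V. ksplit.
    { kintros u Hu. kapply HV. exact Hu. }
    kexists q. ksplit; [exact Hq|]. kor Hw1.
    + apply or_l. kinst Hs b. kd Hs as (Hs & _). kinst Hs Hw1. exact (and_r _ _ _ Hs).
    + apply or_r. kinst Ht b. kd Ht as (Ht & _). kinst Ht Hw1. exact (and_r _ _ _ Ht).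
  - apply J_unfold in Hb. kd Hb as (Hb & U & HU & q' & Hq' & Hr).
    (* Any admissible [U] is contained in the union [V] of all earlier stages, so the single join
       [q] serves for every choice of [U]. *)
    assert (Hle : G ⊢ holds le q' q).
    { eapply sup_lub; [exact Hq' | exact HL |]. kintros u Hu.
      eapply sup_ub; [exact Hq|]. kapply HV. kinst HU (u, Hu). exact HU. }
    kapply Hw2. kor Hr.
    + apply or_l. kapply Hs. ksplit; [exact Hb|]. eapply le_trans; eassumption.
    + apply or_r. kd Hr as (a' & Ha' & Hr). kapply Ht. ksplit; [exact Hb|].
      kexists a'. ksplit; [exact Ha'|]. eapply le_trans; eassumption.
Qed.

(** * Closure at a weakly regular set *)

Lemma premises_set G : G ⊢ setting ->
  G ⊢ ∃ P, ∀ W, W ∈ P ⟷ (∃ b ∈ B, ∃ V, holds D b V ∧ W ∈ V).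
Proof.
  intros H. apply (union_of_sets (fun b W => ∃ V, holds D b V ∧ W ∈ V)).
  { intros ? **; prm. }
  kintros b Hb. kd H as (H & _). kd H as (_ & H & _). kd H as (_ & Htot & Huniq).
  kinst Htot (b, Hb). kd Htot as (V & HV). kexists V. kintro W. ksplit.
  - kintro HW. kexists V. ksplit; assumption.
  - kintro HW. kd HW as (V' & HV' & HW). kinst Huniq (b, V', V, HV', HV).
    krew Huniq. exact HW.
Qed.

Lemma closed_set G : G ⊢ setting ->
  G ⊢ ∃ Y, Phi_closed L le B Phi (elts Y) ∧ (∀ b ∈ Y, ∃ a, J a b).
Proof.
  intros H. pose proof (premises_set _ H) as HP. kd HP as (P & HP).
  assert (Hbd : G ⊢ ∃ alpha, is_bound le B Phi alpha).
  { kd H as (_ & _ & _ & H & _). exact (and_r _ _ _ H). }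
  kd Hbd as (alpha & Hbd).
  (* The two kinds of rules need the weakly regular set to contain the members of the bound and the
     members of all [D(b)], respectively. *)
  pose proof (binary_union G alpha P) as Hc. kd Hc as (c & Hc).
  pose proof (wREA_ax G c) as HA. kd HA as (A & HcA & HA).
  assert (HY : G ⊢ ∀ x ∈ A, is_set (J x)).
  { pose proof (J_set _ H) as HJ. kintros x Hx. kapply HJ. }
  apply (union_of_sets J) in HY; [|intros ? **; prm]. kd HY as (Y & HY).
  assert (HYB : G ⊢ ∀ b ∈ Y, b ∈ B).
  { kintros b Hb. kinst HY b. kd HY as (HY & _). kinst HY Hb. kd HY as (a & _ & HY).
    eapply J_B, HY. }
  assert (HYi : G ⊢ ∀ v, ∀ b, v ∈ A ⟶ J v b ⟶ b ∈ Y).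
  { kintros v b Hv Hb. kapply HY. kexists v. ksplit; assumption. }
  assert (HYe : G ⊢ ∀ b ∈ Y, ∃ a ∈ A, J a b).
  { kintros b Hb. kinst HY b. kd HY as (HY & _). kinst HY Hb. kd HY as (a & Ha & HY).
    kexists a. ksplit; assumption. }
  kexists Y. ksplit; [ksplit; [|ksplit]|].
  - exact HYB.
  - kintros U HU j Hj b. kintro Hb. kd Hb as (Hb & Hle).
    assert (HUB : G ⊢ subset U B).
    { kintros u Hu. kapply HYB. kapply HU. exact Hu. }
    pose proof (and_l _ _ _ (presented _ _ _ H Hb HUB)) as HW.
    apply (cut_imp _ _ _ _ HW); clear HW.
    { kexists j. ksplit; assumption. }
    intros HW. kd HW as (V & HV & W & HW & HWU).
    assert (HWA : G ⊢ W ∈ A).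
    { kapply HcA. kapply Hc. apply or_r. kapply HP. kexists b. ksplit; [exact Hb|].
      kexists V. ksplit; assumption. }
    assert (E : G ⊢ ∀ w ∈ W, ∃ a ∈ A, J a w).
    { kintros w Hw. kapply HYe. kapply HU. kapply HWU. exact Hw. }
    (* Here [U] need not belong to [A], whereas its subset [W] from [D(b)] does; a single [v ∈ A]
       then has stages covering [W]. *)
    apply (weakly_regular_rel (fun w a => J a w)) in E;
      [|intros ? **; prm|exact HA|exact HWA].
    kd E as (v & Hv & E). kinst HYi (v, b, Hv). kapply HYi. apply J_fold.
    ksplit; [exact Hb|]. kexists W. ksplit; [exact E|].
    assert (HWB : G ⊢ subset W B).
    { kintros w Hw. kapply HUB. kapply HWU. exact Hw. }
    (* The converse direction of the presentation gives [b ≤ ⋁W], because [W] itself is a member of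
       [D(b)]. *)
    pose proof (and_r _ _ _ (presented _ _ _ H Hb HWB)) as Hq.
    apply (cut_imp _ _ _ _ Hq); clear Hq.
    { kexists V. ksplit; [exact HV|]. kexists W. ksplit; [exact HW|].
      kintros w Hw. exact Hw. }
    intros Hq. kd Hq as (q & Hq & Hbq). kexists q. ksplit; [exact Hq|].
    apply or_l, Hbq.
  - kintros b a Hba Hsub. khave Hx := Hbd (b, a, Hba).
    kd Hx as (x & Hx & s & Hs & f & Hf). kd Hf as (Hf & Hsurj).
    kd Hf as (Hfp & Htot & Huniq).
    assert (HxA : G ⊢ x ∈ A).
    { kapply HcA. kapply Hc. apply or_l, Hx. }
    (* Regularity is applied on the member [x] of the bound, relating [u] to a stage that contains
       [f(u)]; surjectivity of [f] carries the covering over to [s = ↓a]. *)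
    assert (E : G ⊢ ∀ u ∈ x, ∃ a ∈ A, ∃ c, holds (elts f) u c ∧ J a c).
    { kintros u Hu. kinst Htot (u, Hu). kd Htot as (d & Hd).
      assert (Hds : G ⊢ elts s d).
      { apply (sub_prod_r (elts f) (elts x) (elts s) G u d);
          auto using par_elts. }
      assert (HdY : G ⊢ d ∈ Y).
      { kapply Hsub. kapply Hs. exact Hds. }
      kinst HYe (d, HdY). kd HYe as (a' & Ha' & HJ). kexists a'.
      ksplit; [exact Ha'|]. kexists d. ksplit; assumption. }
    apply (weakly_regular_rel (fun u a => ∃ c, holds (elts f) u c ∧ J a c)) in E;
      [|intros ? **; prm|exact HA|exact HxA].
    kd E as (v & Hv & E). kinst HYi (v, b, Hv). kapply HYi. apply J_fold.
    ksplit; [eapply Phi_B; eassumption|]. kexists s. ksplit.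
    { kintros d Hd. kinst Hsurj (d, Hd). kd Hsurj as (u & Hu & Hud).
      kinst E (u, Hu). kd E as (y & Hy & d' & Hd' & HJ).
      kinst Huniq (u, d', d, Hd', Hud). krew Huniq. kexists y. ksplit; assumption. }
    pose proof (Phi_L _ _ _ H Hba) as HaL.
    kexists a. ksplit.
    + pose proof (generated _ _ H HaL) as Hs'. kd Hs' as (s' & Hs' & Hsup).
      (* Both sets represent [↓a], so the join property of [s'] passes to [s]. *)
      assert (Es : G ⊢ s' ≐ s).
      { apply ext_sub.
        - kintros d Hd. kapply Hs. kapply Hs'. exact Hd.
        - kintros d Hd. kapply Hs'. kapply Hs. exact Hd. }
      krew Es. exact Hsup.
    + apply or_r. kexists a. ksplit; [exact Hba|]. apply le_refl; assumption.
  - kintros b Hb. kinst HYe (b, Hb). kd HYe as (a & _ & HJ). kexists a. exact HJ.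
Qed.

Definition I (b : tm) : fm := ∃ a, J a b.

Lemma par_I : par I.
Proof. unfold I; prm. Qed.

Lemma crel_I l : crel l I I.
Proof. apply par_crel, par_I. Qed.
#[local] Hint Resolve crel_I : par.

Lemma I_least Y G : par Y -> G ⊢ setting -> G ⊢ Phi_closed L le B Phi Y ->
  G ⊢ sub_class I Y.
Proof.
  intros HY H HC. pose proof (J_least _ _ HY H HC) as HJ.
  kintros b Hb. kd Hb as (a & Hb). kapply HJ. exact Hb.
Qed.

(** The closed set [Y] consists of elements of stages, and [I] lies in every closed class, in
    particular in [Y]. *)
Lemma I_set G : G ⊢ setting ->
  G ⊢ ∃ Y, Phi_closed L le B Phi (elts Y) ∧ is_set_of Y I.
Proof.
  intros H. pose proof (closed_set _ H) as HY. kd HY as (Y & HC & HY).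
  pose proof (I_least _ _ (par_elts Y) H HC) as HI.
  kexists Y. ksplit; [exact HC|]. kintro b. ksplit; [kapply HY | kapply HI].
Qed.

(** * The join as least fixed point *)

(** Here [y] is [Γ x]. If [(b, a) ∈ Φ] and [↓a ⊆ ↓x], then [a ≤ x] since [a] is the join of its
    generators, so [b ≤ Γ x ≤ x]. *)
Lemma down_closed G (x y : nat) : G ⊢ setting -> G ⊢ L x -> G ⊢ holds Gam x y ->
  G ⊢ holds le y x -> G ⊢ Phi_closed L le B Phi (down le B x).
Proof.
  intros H Hx Hy Hle. ksplit; [|ksplit].
  - kintros b Hb. exact (and_l _ _ _ Hb).
  - kintros U HU j Hj b. kintro Hb. kd Hb as (Hb & Hbj). ksplit; [exact Hb|].
    eapply le_trans; [exact H | exact Hbj |].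
    eapply sup_lub; [exact Hj | exact Hx |].
    kintros u Hu. kinst HU (u, Hu). exact (and_r _ _ _ HU).
  - kintros b a Hba Hsub. ksplit; [eapply Phi_B; eassumption|].
    eapply le_trans; [exact H | | exact Hle].
    eapply Gam_rule; try eassumption.
    apply below_le; [exact H | eapply Phi_L; eassumption | exact Hx |].
    kintros c Hc. kinst Hsub (c, Hc). exact (and_r _ _ _ Hsub).
Qed.

(** Phrased for pre-fixed points, so that it covers [Γ p] as well as arbitrary fixed points. *)
Lemma sup_I_least G (i p x y : nat) : G ⊢ setting -> G ⊢ is_set_of i I ->
  G ⊢ is_sup L le i p -> G ⊢ L x -> G ⊢ holds Gam x y -> G ⊢ holds le y x ->
  G ⊢ holds le p x.
Proof.
  intros H Hi Hp Hx Hy Hle. eapply sup_lub; [exact Hp | exact Hx |].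
  assert (HC : G ⊢ sub_class I (down le B x)).
  { apply I_least; [|exact H|eapply down_closed; eassumption].
    prm. }
  kintros b Hb. kinst Hi b. kd Hi as (Hi & _). kinst Hi Hb. kinst HC (b, Hi).
  exact (and_r _ _ _ HC).
Qed.

Lemma sup_I_fixed G (i p : nat) : G ⊢ setting -> G ⊢ Phi_closed L le B Phi (elts i) ->
  G ⊢ is_set_of i I -> G ⊢ is_sup L le i p -> G ⊢ least_fixed_point L le Gam p.
Proof.
  intros H HC Hi Hp. pose proof (sup_L _ _ _ Hp) as HL.
  pose proof (Gam_value _ _ H HL) as Hy. kd Hy as (y & Hy).
  pose proof (Gam_is_Gamma _ _ _ H HL Hy) as HG. kd HG as (s & Hs & Hsup).
  pose proof (sup_L _ _ _ Hsup) as HLy.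
  assert (Hyp : G ⊢ holds le y p).
  { eapply sup_lub; [exact Hsup | exact HL |]. kintros b Hb.
    eapply sup_ub; [exact Hp|].
    kinst Hs b. kd Hs as (Hs & _). kinst Hs Hb. kd Hs as (HbB & a & Hba & Hap).
    kd HC as (_ & HC & HR). kinst HR (b, a, Hba). kapply HR.
    (* From [c ≤ a ≤ p] and [c_L]-closedness applied to [i] itself, [c] lies in [i]. *)
    kintros c Hc. kd Hc as (Hc & Hca). kinst HC i. apply (cut_imp _ _ _ _ HC); clear HC.
    { kintros u Hu. exact Hu. }
    intros HC. kinst HC (p, Hp). kapply HC. ksplit; [exact Hc|].
    eapply le_trans; eassumption. }
  assert (Hpy : G ⊢ holds le p y).
  (* The Knaster-Tarski argument: [Γ p ≤ p] gives [Γ(Γ p) ≤ Γ p] by monotonicity, so [Γ p] is a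
     pre-fixed point and lies above [p]. *)
  { pose proof (Gam_value _ _ H HLy) as Hz. kd Hz as (z & Hz).
    eapply sup_I_least; try eassumption. eapply Gam_mono; eassumption. }
  pose proof (le_antisym _ _ _ H Hyp Hpy) as E.
  ksplit; [exact HL|]. ksplit.
  - krew E. exact Hy.
  - kintros x Hx Hxx. eapply sup_I_least; try eassumption.
    apply le_refl; assumption.
Qed.

(** * Passing from the class to its defining formula *)

Lemma I_form_closed G :
  G ⊢ setting ⟶ Phi_closed L le B Phi (cls (open_var I)).
Proof.
  kintro H. apply I_set in H. kd H as (Y & HC & HY).
  apply (Phi_closed_ext L le kB Phi (cls (open_var I)) (elts Y));
    auto using par_cls, par_elts.
  pose proof (cls_open I G par_I) as E.
  kintro x. kinst E x. kinst HY x. kd E as (E1 & E2). kd HY as (H1 & H2).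
  ksplit; kintro Hx.
  - kapply H2. kapply E1. exact Hx.
  - kapply E2. kapply H1. exact Hx.
Qed.

Lemma I_form_least fY G :
  G ⊢ setting ⟶ Phi_closed L le B Phi (cls fY) ⟶
      sub_class (cls (open_var I)) (cls fY).
Proof.
  kintros H HC. pose proof (I_least _ _ (par_cls fY) H HC) as HI.
  pose proof (cls_open I G par_I) as E.
  kintros x Hx. kapply HI. kapply E. exact Hx.
Qed.

Lemma sup_I_form G :
  G ⊢ setting ⟶ ∃ i, is_set_of i (cls (open_var I)) ∧
    ∃ p, is_sup L le i p ∧ least_fixed_point L le Gam p.
Proof.
  kintro H. pose proof (I_set _ H) as HY. kd HY as (Y & HC & HY).
  assert (HYB : G ⊢ subset Y B).
  { kd HC as (HC & _). exact HC. }
  pose proof (sup_exists _ _ H HYB) as Hp. kd Hp as (p & Hp).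
  pose proof (cls_open I G par_I) as E.
  kexists Y. ksplit; [|kexists p; ksplit; [exact Hp|eapply sup_I_fixed; eassumption]].
  kintro x. kinst E x. kinst HY x. kd E as (E1 & E2). kd HY as (H1 & H2).
  ksplit; kintro Hx.
  - kapply E2. kapply H1. exact Hx.
  - kapply H2. kapply E1. exact Hx.
Qed.

End InductiveDefinition.

(* L, le, D, Gam, Phi are arbitrary class formulas, possibly with parameters, and
   the set B is an arbitrary free variable.  I is the class I(Phi); its leastness
   quantifies over all classes Y, hence over all formulas. *)
Theorem corollary4p11 :
  forall (fL fle fD fGam fPhi : form) (kB : nat),
  let L := cls fL in
  let le := cls fle in
  let D := cls fD in
  let Gam := cls fGam in
  let Phi := cls fPhi in
  let B := fv kB in
  let hyps : fm :=
    (set_presented L le B D ∧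
     monotone_operator L le Gam ∧
     abstract_ind_def L B Phi ∧
     bounded L le B Phi ∧
     eq_Gamma_of L le B Phi Gam)%fm in
  exists fI : form,
  let I := cls fI in
  provable (hyps ⟶ Phi_closed L le B Phi I)%fm /\
  (forall fY : form, let Y := cls fY in
     provable (hyps ⟶ Phi_closed L le B Phi Y ⟶ sub_class I Y)%fm) /\
  provable (hyps ⟶
    ∃ i, is_set_of i I ∧
      ∃ p, is_sup L le i p ∧ least_fixed_point L le Gam p)%fm.
Proof.
  (* The class of all [b] in some stage is given by one formula, chosen before any competing class
     [Y]. *)
  intros. exists (open_var (I fL fle fPhi kB)).
  repeat apply conj; [|intros fY Y|].
  - apply I_form_closed.
  - apply I_form_least.
  - apply sup_I_form.
Qed.
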